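(* Let $k,t,d$ be positive integers and let $n=t(k-1)$. Given $t$ probability measures $\mu_1,\dots,\mu_t$ on $\mathbb{R}^d$, absolutely continuous with respect to Lebesgue measure, and $n$ directions $v_1,\dots,v_n$ in $\mathbb{R}^d$, there are hyperplanes $H_1,\dots,H_n$ in $\mathbb{R}^d$, with $H_i$ orthogonal to $v_i$ for each $i$, such that the parts of the partition of $\mathbb{R}^d$ induced by $H_1,\dots,H_n$ can be distributed among $k$ sets $A_1,\dots,A_k$ with $$\mu_j(A_i)=\frac1k\qquad\text{for all } 1\le i\le k,\ 1\le j\le t.$$
   Context: A direction in $\mathbb{R}^d$ is a nonzero vector. The parts of the partition of $\mathbb{R}^d$ induced by hyperplanes $H_1,\dots,H_n$ are the closures of the connected components of $\mathbb{R}^d\setminus(H_1\cup\dots\cup H_n)$ (they overlap only in null sets). Distributing the parts among $k$ sets means assigning each part to exactly one of $A_1,\dots,A_k$, where $A_i$ is the union of the parts assigned to it (possibly none). *)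

(* Defs.v *)
From mathcomp Require Import all_boot all_order all_algebra.
From mathcomp Require Import all_classical all_reals all_analysis.
Import Order.TTheory GRing.Theory Num.Theory.
Import numFieldNormedType.Exports.

Set Implicit Arguments.
Unset Strict Implicit.
Unset Printing Implicit Defensive.

Local Open Scope classical_set_scope.
Local Open Scope ring_scope.

Notation borel_rV R d := (g_sigma_algebraType (@open 'rV[R]_d)).

(* Lebesgue measure on R^d as the d-fold product of the one-dimensional one:
   the measure of A is the integral over its first coordinate of the measures
   of its sections, as in the library's definition of m1 \x m2, with R^d.+1
   read as R * R^d through row_mx.  It is meant to be used on Borel sets. *)
Fixpoint lebesgue_rV (R : realType) (d : nat) : set (borel_rV R d) -> \bar R :=
  match d with
  | 0 => fun A => (\1_A (0 : 'rV[R]_0))%:E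
  | d'.+1 => fun A =>
      (\int[@lebesgue_measure R]_x
         lebesgue_rV [set y : 'rV[R]_d' | A (row_mx (x%:M : 'rV[R]_1) y)])%E
  end.

Definition dotp (R : realType) (d : nat) (x y : 'rV[R]_d) : R :=
  \sum_(l < d) x 0 l * y 0 l.

Definition hyperplane_orthogonal (R : realType) (d : nat)
    (v : 'rV[R]_d) (H : set 'rV[R]_d) : Prop :=
  exists c : R, H = [set x | dotp x v = c].

Definition parts (R : realType) (d n : nat) (H : 'I_n -> set 'rV[R]_d) :
    set (set 'rV[R]_d) :=
  let U := ~` \bigcup_(i in [set: 'I_n]) H i in
  [set closure (connected_component U x) | x in U].

(* f sends each part to the index of the unique set that receives it; its
   values on sets that are not parts are irrelevant. *)
Definition distributed (R : realType) (d n k : nat)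
    (H : 'I_n -> set 'rV[R]_d) (f : set 'rV[R]_d -> 'I_k) (i : 'I_k) :
    set 'rV[R]_d :=
  \bigcup_(P in [set P | parts H P /\ f P = i]) P.

(* Main.v *)
Require Import Defs.
From mathcomp Require Import all_boot all_order all_algebra.
From mathcomp Require Import all_classical all_reals all_analysis.
From mathcomp Require Import measurable_realfun.
From mathcomp Require Import ring lra zify.
Import Order.TTheory GRing.Theory Num.Theory.
Import numFieldNormedType.Exports.

(* For a prime number p of pieces, cut R^d successively: the half-space
   <x,v_i> < c_i receives the label g_i, the remaining half-space is cut by the
   next direction.  Moving c_i from -oo to +oo joins the configuration made of
   the previous cuts to the constant labeling g_i, so that the configurations
   contain an N-dimensional complex, N = t(p-1), obtained by coning alternately
   over (g - 1) and 1 + g + ... + g^(p-1), g the shift of the labels by 1.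
   Pairing it with the standard cocycles of Z/p gives 1 in F_p (in place of the
   topological index of a Z/p-space); hence every equivariant labeling of a fine
   grid on it by Z/p alternates along some flag of N+1 cells.  If no
   configuration were fair, then by compactness all would be unfair by at least
   e > 0, and the labels with maximal mass would give to every cell a nonempty
   set of pairs (label, measure) with at most p-1 labels for each measure; along
   a flag of N+1 cells these sets, of size in [1, N], cannot increase strictly,
   which contradicts alternation.  Composite numbers of pieces follow by
   splitting each piece again.  Finally the convex cells on which the pattern of
   sides is constant are the parts, up to null sets. *)

Set Implicit Arguments.
Unset Strict Implicit.
Unset Printing Implicit Defensive.

Local Open Scope classical_set_scope.
Local Open Scope ring_scope.

(** * Cochains and subdivided cones *)

(* Cochains are functions on sequences, seen as ordered simplices; this is the
   alternating sum over the faces, unfolded along the first vertex. *)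
Fixpoint cobd (Q : Type) (F : comPzRingType) (f : seq Q -> F) (s : seq Q) : F :=
  if s is x :: s' then f s' - cobd (fun u => f (x :: u)) s' else 0.

Lemma cobd_map (Q Q' : Type) (F : comPzRingType) (l : Q -> Q') (f : seq Q' -> F) s :
  cobd (fun u => f (map l u)) s = cobd f (map l s).
Proof. by elim: s f => //= x s IH f; rewrite (IH (fun u => f (l x :: u))). Qed.

Section Cochains.
Variables (Q : Type) (F : comPzRingType).
Implicit Types (f g : seq Q -> F) (s : seq Q) (v e : Q -> Q).

(* The prism between v s and e s:
   \sum_j (-1)^j f (v x_0, ..., v x_j, e x_j, ..., e x_n). *)
Fixpoint prism v e f s : F :=
  if s is x :: s' then
    f (v x :: e x :: map e s') - prism v e (fun u => f (v x :: u)) s'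
  else 0.

Lemma eq_cobd f g s :
  (forall u, size u = (size s).-1 -> f u = g u) -> cobd f s = cobd g s.
Proof.
elim: s f g => //= x s IH f g fg; rewrite fg//; congr (_ - _).
case: s IH fg => // y s IH fg.
by apply: IH => u su; apply: fg; rewrite /= su.
Qed.

Lemma cobdD f g s : cobd (fun u => f u + g u) s = cobd f s + cobd g s.
Proof.
elim: s f g => [|x s IH] f g /=; first by rewrite addr0.
by rewrite IH opprD addrACA.
Qed.

Lemma cobdZ a f s : cobd (fun u => a * f u) s = a * cobd f s.
Proof.
elim: s f => [|x s IH] f /=; first by rewrite mulr0.
by rewrite IH mulrBr.
Qed.

Lemma cobdN f s : cobd (fun u => - f u) s = - cobd f s.
Proof.
by rewrite -mulN1r -cobdZ; apply: eq_cobd => u _; rewrite mulN1r.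
Qed.

Lemma cobd_sum n (f : nat -> seq Q -> F) s :
  cobd (fun u => \sum_(k < n) f k u) s = \sum_(k < n) cobd (f k) s.
Proof.
elim: n => [|n IH].
  rewrite big_ord0 -[RHS](mul0r (cobd (fun=> 1) s)) -cobdZ.
  by apply: eq_cobd => u _; rewrite big_ord0 mul0r.
rewrite big_ord_recr /= -IH -cobdD.
by apply: eq_cobd => u _; rewrite big_ord_recr.
Qed.

Lemma cobd_cobd f s : cobd (cobd f) s = 0.
Proof.
elim: s f => //= x s IH f.
by rewrite cobdD cobdN IH subr0 subrr.
Qed.

(** Agreement is asked only on the simplices of the prism, so that cochains can later be compared on
    admissible simplices alone. *)
Lemma eq_prism v e f g s :
  (forall s1 x s2, s = s1 ++ x :: s2 ->
    f (map v s1 ++ v x :: e x :: map e s2) =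
    g (map v s1 ++ v x :: e x :: map e s2)) ->
  prism v e f s = prism v e g s.
Proof.
elim: s f g => //= x s IH f g fg.
rewrite (fg [::] x s)//; congr (_ - _).
by apply: IH => s1 y s2 E; apply: (fg (x :: s1)); rewrite E.
Qed.

Lemma prismD v e f g s :
  prism v e (fun u => f u + g u) s = prism v e f s + prism v e g s.
Proof.
elim: s f g => [|x s IH] f g /=; first by rewrite addr0.
by rewrite IH opprD addrACA.
Qed.

Lemma prismN v e f s : prism v e (fun u => - f u) s = - prism v e f s.
Proof.
by elim: s f => [|x s IH] f /=; rewrite ?oppr0// IH opprD.
Qed.

Lemma prism_homotopy v e f s :
  prism v e (cobd f) s + cobd (prism v e f) s = f (map e s) - f (map v s).
Proof.
elim: s f => [|x s IH] f /=; first by rewrite subrr addr0.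
rewrite prismD prismN cobdD cobdN (cobd_map e (fun u => f (v x :: e x :: u))).
have /= := IH (fun u => f (v x :: u)).
move=> /(congr1 (fun z => z + f (v x :: map v s))); rewrite subrK => <-; ring.
Qed.

End Cochains.

Section Shift.
Variables (F : comPzRingType) (p : nat) (p_gt0 : (0 < p)%N) (Q : Type) (act : Q -> Q).
Hypothesis act_p : forall q, iter p act q = q.
Implicit Types (f g : seq Q -> F) (s : seq Q).

(* The differentials of the periodic resolution of the cyclic group: norm and
   difference. *)
Definition shift (i : nat) f s : F :=
  if odd i then \sum_(k < p) f (map (iter k act) s)
  else f (map act s) - f s.

Lemma shiftD i f g s :
  shift i (fun u => f u + g u) s = shift i f s + shift i g s.
Proof.
by rewrite /shift; case: ifP => _; [rewrite big_split|rewrite opprD addrACA].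
Qed.

Lemma shiftN i f s : shift i (fun u => - f u) s = - shift i f s.
Proof.
by rewrite /shift; case: ifP => _; [rewrite sumrN|rewrite opprB opprK addrC].
Qed.

Lemma shift_cobd i f s : shift i (cobd f) s = cobd (shift i f) s.
Proof.
rewrite /shift; case: (odd i).
  rewrite (cobd_sum p (fun k u => f (map (iter k act) u))).
  by apply: eq_bigr => k _; rewrite -cobd_map.
by rewrite cobdD cobdN cobd_map.
Qed.

Lemma shift_shift i f s : shift i (shift i.+1 f) s = 0.
Proof.
suff : \sum_(k < p) f (map act (map (iter k act) s)) =
       \sum_(k < p) f (map (iter k act) s).
  rewrite /shift /=; case: (odd i) => /= E.
    by rewrite big_split/= sumrN E subrr.
  rewrite -E; apply/eqP; rewrite subr_eq0; apply/eqP.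
  by apply: eq_bigr => k _; rewrite -!map_comp; congr f; apply: eq_map => q /=; rewrite -iterSr.
rewrite -(prednK p_gt0) big_ord_recr big_ord_recl addrC /=.
congr (_ + _); last first.
  congr f; rewrite -map_comp; apply: eq_map => q /=.
  by rewrite -iterS prednK// act_p.
by apply: eq_bigr => k _; congr f; rewrite -map_comp.
Qed.

End Shift.

Lemma sum_modn_shift q n :
  (\sum_(k < q.+1) ((n + k) %% q.+1) = \sum_(k < q.+1) (k %% q.+1))%N.
Proof.
elim: n => [|n <-]; first by apply: eq_bigr => k _; rewrite add0n.
rewrite big_ord_recr [in RHS]big_ord_recl /= addn0 addSnnS modnDr addnC.
by congr addn; apply: eq_bigr => k _; rewrite /bump/= add1n addSnnS.
Qed.

(** * Cocycles of the cyclic group *)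

Section LabelCochains.
Variables (p : nat) (p_pr : prime p).
Implicit Types (a b c : 'F_p) (l : seq 'F_p).

(** With representatives in [0, p), this tells whether the arc going up from a to b passes 0. It is
    not invariant under translation, but its coboundary [carry] is. *)
Definition wrap a b : 'F_p := (val b < val a)%:R.

Definition carry a b c : 'F_p := wrap a b + wrap b c - wrap a c.

Lemma wrapxx a : wrap a a = 0. Proof. by rewrite /wrap ltnn. Qed.

(* [theta r] is the r-th cup power of the carry cocycle, [theta_odd r] its
   product with the generator of degree 1.  They vanish as soon as two
   consecutive labels coincide. *)
Fixpoint theta (r : nat) l : 'F_p :=
  if r is r'.+1 then
    if l is [:: a, b, c & l'] then carry a b c * theta r' (c :: l') else 0
  else 1.

Definition theta_odd r l : 'F_p :=
  if l is [:: a, b & l'] then (b - a) * theta r (b :: l') else 0.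

(* Non-invariant cochains: the norm of [psi r] is [theta_odd r] and its
   coboundary is [theta r.+1]; the difference of [rho r] is [theta r] and its
   coboundary is [theta_odd r]. *)
Definition psi r l : 'F_p :=
  if l is [:: a, b & l'] then wrap a b * theta r (b :: l') else 0.

Definition rho r l : 'F_p := head 0 l * theta r l.

Lemma val_natr n : val (n%:R : 'F_p) = (n %% p)%N.
Proof. exact: (val_Fp_nat p_pr n). Qed.

Lemma val_Fp_lt a : (val a < p)%N.
Proof. by have := ltn_ord a; rewrite [X in (_ < X)%N](Fp_cast p_pr). Qed.

Lemma val_add1 a : val (a + 1) = if val a == p.-1 then 0%N else (val a).+1.
Proof.
have p0 := prime_gt0 p_pr.
rewrite -{1}[a]natr_Zp natr1 val_natr; have := val_Fp_lt a.
rewrite /=; move: (nat_of_ord a) => x; case: eqP => [->|/eqP ne] ap; first by rewrite prednK// modnn.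
by rewrite modn_small// -(prednK p0) ltnS ltn_neqAle ne -ltnS prednK.
Qed.

(** A translation changes [wrap] by the coboundary of the indicator of p - 1, which cancels in
    [carry]. *)
Lemma wrap_add1 a b :
  wrap (a + 1) (b + 1) = wrap a b + (val b == p.-1)%:R - (val a == p.-1)%:R.
Proof.
have le x : (val (x : 'F_p) <= p.-1)%N.
  by have := val_Fp_lt x; have := prime_gt0 p_pr; lia.
rewrite /wrap !val_add1; have := le a; have := le b.
case: eqP => [->|/eqP nb] lb; case: eqP => [->|/eqP na] la; rewrite ?ltnn ?ltnS ?ltn0.
- by rewrite add0r subrr.
- by rewrite ltnNge la add0r subr0.
- by rewrite ltn_neqAle nb lb /= addr0 subrr.
- by rewrite addr0 subr0.
Qed.

Lemma carry_add1 a b c : carry (a + 1) (b + 1) (c + 1) = carry a b c.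
Proof. by rewrite /carry !wrap_add1; ring. Qed.

Lemma theta_add1 r l : theta r (map (+%R^~ 1) l) = theta r l.
Proof.
elim: r l => //= r IH [|a [|b [|c l]]] //=.
by rewrite carry_add1; have /= -> := IH (c :: l).
Qed.

(* Exactly b - a of the p translates of the arc from a to b wrap around 0. *)
Lemma sum_wrap a b : \sum_(k < p) wrap (a + k%:R) (b + k%:R) = b - a.
Proof.
have p0 := prime_gt0 p_pr; have p1 := prime_gt1 p_pr.
have shiftE c k : val (c + k%:R) = ((val c + k) %% p)%N.
  by rewrite -{1}[c]natr_Zp -natrD val_natr.
have := sum_modn_shift p.-1; rewrite prednK// => sumE.
pose d := val (b - a).
(* Adding [d] to a representative costs at most one subtraction of p. Over all k, both families of
   representatives have the same sum, which leaves p * (number of wraps) = p * d. *)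
have wrapE k : (val (b + k%:R)%R + p * (val (b + k%:R)%R < val (a + k%:R)%R) =
    val (a + k%:R)%R + d)%N.
  have -> : b + k%:R = (a + k%:R) + d%:R by rewrite natr_Zp; ring.
  rewrite shiftE; move: (a + k%:R) => x.
  have xp := val_Fp_lt x; have dp : (d < p)%N := val_Fp_lt (b - a).
  have [lt|ge] := ltnP (val x + d) p.
    by rewrite modn_small// ltnNge leq_addr muln0 addn0.
  rewrite -(subnK ge) modnDr modn_small; last by lia.
  suff -> : (val x + d - p < val x)%N by rewrite muln1 subnK.
  by lia.
have : (\sum_(k < p) (val (b + k%:R)%R + p * (val (b + k%:R)%R < val (a + k%:R)%R)) =
    \sum_(k < p) (val (a + k%:R)%R + d))%N by apply: eq_bigr => k _; apply: wrapE.
rewrite !big_split /= -big_distrr /= sum_nat_const card_ord.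
have shiftE' c (k : 'I_p) : nat_of_ord (c + k%:R)%R = ((val c + k) %% p)%N by apply: shiftE.
rewrite (eq_bigr _ (fun k _ => shiftE' b k)) [in RHS](eq_bigr _ (fun k _ => shiftE' a k)).
rewrite !sumE => /addnI /eqP; rewrite eqn_pmul2l// => /eqP sumd.
rewrite /wrap -natr_sum sumd; exact: natr_Zp.
Qed.

(** If [theta m] is a cocycle, then [theta m.+1] is the coboundary of [psi m], hence a cocycle by
    [cobd_cobd]; the two claims feed each other. *)
Lemma cobd_psi_theta r :
  (forall l, size l = r.*2.+2 -> cobd (theta r) l = 0) /\
  (forall l, size l = r.*2.+3 -> cobd (psi r) l = theta r.+1 l).
Proof.
have step m : (forall l, size l = m.*2.+2 -> cobd (theta m) l = 0) ->
    forall l, size l = m.*2.+3 -> cobd (psi m) l = theta m.+1 l.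
  move=> cocy [|a [|b [|c l]]] //= [sl].
  rewrite -/(cobd (fun u => wrap a b * theta m (b :: u)) (c :: l)).
  rewrite cobdZ /=.
  have /= := cocy [:: b, c & l]; rewrite sl => /(_ erefl) /eqP.
  rewrite subr_eq0 => /eqP ->; rewrite /carry; ring.
have cocy : forall m l, size l = m.*2.+2 -> cobd (theta m) l = 0.
  elim=> [|m IH] l sl.
    by case: l sl => [|a [|b [|]]]//= _; rewrite subr0 subrr.
  rewrite -(cobd_cobd (psi m) l); apply: eq_cobd => u su.
  by rewrite step// su sl.
by split; [exact: cocy | exact: step (cocy r)].
Qed.

Lemma cobd_theta r l : size l = r.*2.+2 -> cobd (theta r) l = 0.
Proof. by have [+ _] := cobd_psi_theta r; apply. Qed.

Lemma cobd_psi r l : size l = r.*2.+3 -> cobd (psi r) l = theta r.+1 l.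
Proof. by have [_] := cobd_psi_theta r; apply. Qed.

(** [rho r] is the first label times a cocycle, so only the change of the first label survives. *)
Lemma cobd_rho r l : size l = r.*2.+2 -> cobd (rho r) l = theta_odd r l.
Proof.
case: l => [|a [|b l]] // sl.
have := cobd_theta sl; rewrite /= => /eqP; rewrite subr_eq0 => /eqP E.
rewrite {1}/rho /= -/(cobd (fun u => a * theta r (a :: u)) (b :: l)) cobdZ /= -E; ring.
Qed.

Definition Theta i := if odd i then theta_odd i./2 else theta i./2.

Let alternating := sorted (fun a b : 'F_p => a != b).

Lemma theta_alternating r l :
  size l = r.*2.+1 -> theta r l != 0 -> alternating l.
Proof.
elim: r l => [|r IH] [|a [|b [|c l]]]//= [sl].
rewrite mulf_eq0 negb_or => /andP[ne0 /(IH (c :: l)) IHl].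
have {}IHl : path (fun a b => a != b) c l by apply: IHl; rewrite /= sl.
rewrite /alternating /= IHl andbT.
by apply/andP; split; apply: contraNneq ne0; rewrite /carry => ->; apply/eqP; rewrite wrapxx; ring.
Qed.

Lemma Theta_alternating i l : size l = i.+1 -> Theta i l != 0 -> alternating l.
Proof.
rewrite /Theta -{1}(odd_double_half i); case: ifP => [_|_ /theta_alternating]; last exact.
case: l => [|a [|b l]]//= [sl]; rewrite mulf_eq0 negb_or subr_eq0 eq_sym.
move=> /andP[ab /theta_alternating]; rewrite /alternating /= ab; apply.
by rewrite sl.
Qed.

End LabelCochains.

(** * The chain of iterated cones and its pairing with the cocycles *)

Section KyFan.
Variables (p : nat) (p_pr : prime p) (Q : Type) (act : Q -> Q).
(** In the application [Q] consists of sets of labelings, [G i] of flags of i + 1 sets within a grid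
    cell, [cv i 0, ..., cv i M] moves the cut of index i from one end to the other, and [ce i k] is
    the union of two consecutive stages. *)
Variables (M : nat) (cv ce : nat -> nat -> Q -> Q) (q0 : Q) (apex : nat -> Q).
Variable (G : nat -> seq Q -> Prop) (lab : Q -> 'F_p) (N : nat).
Hypothesis act_p : forall q, iter p act q = q.
Hypothesis G0 : G 0 [:: q0].
Hypothesis G_size : forall i s, G i s -> size s = i.+1.
Hypothesis G_act : forall i s, G i s -> G i (map act s).
Hypothesis G_start : forall i s, G i s -> map (cv i 0) s = s.
Hypothesis G_end : forall i s, G i s -> map (cv i M) s = nseq i.+1 (apex i).
Hypothesis G_prism : forall i s1 x s2 k k', G i (s1 ++ x :: s2) -> (k < M)%N ->
  k' = k \/ k' = k.+1 ->
  G i.+1 (map (cv i k') s1 ++ cv i k' x :: ce i k x :: map (ce i k) s2).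
Hypothesis lab_act : forall i s, (i < N)%N -> G i s ->
  map lab (map act s) = map (+%R^~ 1) (map lab s).

Let p_gt0 : (0 < p)%N. Proof. exact: prime_gt0. Qed.
Let pF : p%:R = 0 :> 'F_p. Proof. exact: pchar_Fp_0. Qed.
Implicit Types (f g : seq Q -> 'F_p) (s : seq Q).

(* The path [cv i 0, ..., cv i M] is cut at midpoints [ce i k], and prisms always
   run from a vertex to a midpoint: they preserve flags when [ce i k] enlarges
   both [cv i k] and [cv i k.+1]. *)
Definition cone i f s : 'F_p :=
  \sum_(k < M) (prism (cv i k) (ce i k) f s - prism (cv i k.+1) (ce i k) f s).

(* A chain is represented by the functional evaluating cochains on it. *)
Fixpoint chain i f : 'F_p :=
  if i is i'.+1 then chain i' (shift p act i' (cone i' f)) else f [:: q0].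

Lemma coneD i f g s : cone i (fun u => f u + g u) s = cone i f s + cone i g s.
Proof.
by rewrite -big_split; apply: eq_bigr => k _; rewrite !prismD opprD addrACA.
Qed.

Lemma coneN i f s : cone i (fun u => - f u) s = - cone i f s.
Proof.
by rewrite -sumrN; apply: eq_bigr => k _; rewrite !prismN opprD.
Qed.

Lemma cone_homotopy i f s :
  cone i (cobd f) s + cobd (cone i f) s =
  f (map (cv i M) s) - f (map (cv i 0) s).
Proof.
rewrite (cobd_sum M (fun k u => prism (cv i k) (ce i k) f u -
   prism (cv i k.+1) (ce i k) f u)) -big_split/=.
rewrite -(telescope_sumr (fun k => f (map (cv i k) s)) (leq0n M)) big_mkord.
apply: eq_bigr => k _; rewrite cobdD cobdN addrACA -opprD !prism_homotopy.
ring.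
Qed.

Lemma eq_shift i f g s :
  (forall s, G i s -> f s = g s) -> G i s -> shift p act i f s = shift p act i g s.
Proof.
move=> fg Gs.
have Git k : G i (map (iter k act) s).
  elim: k => [|k IH]; first by rewrite map_id.
  by have := G_act IH; rewrite -map_comp.
rewrite /shift; case: ifP => _; first by apply: eq_bigr => k _; apply: fg.
by rewrite !fg //; apply: G_act.
Qed.

(** The chain is supported on [G], because [G_act] and [G_prism] keep its construction there. *)
Lemma eq_chain i f g : (forall s, G i s -> f s = g s) -> chain i f = chain i g.
Proof.
elim: i f g => [|i IH] f g fg /=; first exact: fg.
apply: IH => s Gs; apply: eq_shift Gs => {}s Gs.
apply: eq_bigr => k _.
by congr (_ - _); apply: eq_prism => s1 x s2 E; apply: fg; apply: G_prism;
  rewrite -?E //; auto.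
Qed.

Lemma chainD i f g : chain i (fun u => f u + g u) = chain i f + chain i g.
Proof.
elim: i f g => //= i IH f g; rewrite -IH; apply: eq_chain => s Gs.
by rewrite -shiftD; apply: eq_shift Gs => {}s Gs; apply: coneD.
Qed.

Lemma chainN i f : chain i (fun u => - f u) = - chain i f.
Proof.
elim: i f => //= i IH f; rewrite -IH; apply: eq_chain => s Gs.
by rewrite -shiftN; apply: eq_shift Gs => {}s Gs; apply: coneN.
Qed.

Lemma chain0 i f : (forall s, G i s -> f s = 0) -> chain i f = 0.
Proof.
move=> f0; rewrite (eq_chain (g := fun u => f u + - f u)) ?chainD ?chainN ?subrr//.
by move=> s /f0 ->; rewrite subrr.
Qed.

Lemma shift_const i a s : shift p act i (fun u => a (size u)) s = 0 :> 'F_p.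
Proof.
rewrite /shift; case: ifP => _; last by rewrite size_map subrr.
under eq_bigr do rewrite size_map.
by rewrite sumr_const card_ord -mulr_natr pF mulr0.
Qed.

(** In [cone_homotopy], the constant simplex at the apex is killed by [shift_const]; the term
    [cobd (cone i f)] becomes, by induction, a composite of norm and difference, which is 0. Only
    the base of the cone remains. *)
Lemma chain_boundary i f : chain i.+1 (cobd f) = - chain i (shift p act i f).
Proof.
have reduce j g : chain j (cobd (shift p act j (cone j g))) = 0 ->
    chain j.+1 (cobd g) = - chain j (shift p act j g).
  move=> E; rewrite /= -chainN -[RHS]subr0 -{}E -chainN -chainD.
  apply: eq_chain => s Gs; rewrite -shift_cobd -shiftN -shiftN -shiftD.
  rewrite -[RHS]add0r -(shift_const j (fun n => g (nseq n (apex j))) s) -shiftD.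
  apply: eq_shift Gs => {}s Gs.
  have := cone_homotopy j g s.
  rewrite G_end// G_start// (G_size Gs).
  by move=> /(congr1 (fun z => z - cobd (cone j g) s)); rewrite addrK => ->; ring.
elim: i f => [|i IH] f; apply: reduce.
  by rewrite /= subr0 /shift /= subrr.
by rewrite IH chain0 ?oppr0// => s Gs; rewrite shift_shift.
Qed.

Let chain_step i (f g h : seq 'F_p -> 'F_p) :
  (forall l, size l = i.+2 -> cobd f l = g l) ->
  (forall s, G i s -> shift p act i (fun u => f (map lab u)) s = h (map lab s)) ->
  chain i.+1 (fun s => g (map lab s)) = - chain i (fun s => h (map lab s)).
Proof.
move=> fg fh.
rewrite -(eq_chain fh) -chain_boundary.
by apply: eq_chain => s Gs; rewrite cobd_map fg// size_map (G_size Gs).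
Qed.

(** Each step transfers a coboundary to the chain one dimension lower, where the norm or difference
    gives the previous cocycle; degree 0 is the evaluation of 1 at a point. *)
Lemma chain_Theta i : (i <= N)%N -> chain i (fun s => Theta i (map lab s)) = (-1) ^+ i.
Proof.
elim: i => [|i IH] // iN; rewrite exprS mulN1r -{}IH ?(ltnW iN)// /Theta /= uphalf_half.
have [io|ie] /= := boolP (odd i).
  apply: (chain_step (f := psi i./2) (g := theta i./2.+1) (h := theta_odd i./2)) => [l sl|s Gs].
    by apply: cobd_psi; rewrite sl -{1}(odd_double_half i) io.
  rewrite /shift io.
  have labE k : map lab (map (iter k act) s) = map (+%R^~ k%:R) (map lab s).
    elim: k => [|k IH].
      by rewrite map_id; elim: (map lab s) => //= a l <-; rewrite addr0.
    have /(lab_act iN) : G i (map (iter k act) s).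
      elim: k {IH} => [|k IH]; first by rewrite map_id.
      by have := G_act IH; rewrite -map_comp.
    move=> E; rewrite (map_comp act (iter k act)) E IH -map_comp.
    by apply: eq_map => x /=; rewrite -addrA natr1.
  under eq_bigr do rewrite labE.
  have : size (map lab s) = i.+1 by rewrite size_map (G_size Gs).
  case: (map lab s) => [|a [|b l]] //= [si]; first by rewrite -si in io.
  clear si.
  under eq_bigr => k _.
    have -> : theta i./2 (b + k%:R :: map (+%R^~ k%:R) l) = theta i./2 (b :: l).
      elim: (nat_of_ord k) => [|{}k IH].
        by rewrite addr0; congr theta; congr cons; elim: l => //= c l ->; rewrite addr0.
      rewrite -IH -[RHS](theta_add1 p_pr) /= -map_comp -addrA natr1.
      by congr (theta _ (_ :: _)); apply: eq_map => x /=; rewrite -addrA natr1.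
    over.
  by rewrite -mulr_suml sum_wrap.
apply: (chain_step (f := rho i./2) (g := theta_odd i./2) (h := theta i./2)) => [l sl|s Gs].
  by apply: cobd_rho; rewrite sl -{1}(odd_double_half i) (negbTE ie).
rewrite /shift (negbTE ie) (lab_act iN Gs) /rho theta_add1//.
have : size (map lab s) = i.+1 by rewrite size_map (G_size Gs).
by case: (map lab s) => //= a l _; ring.
Qed.

(* A Z/p-analogue of Ky Fan's lemma. *)
Lemma exists_alternating :
  exists2 s, G N s & sorted (fun a b => a != b) (map lab s).
Proof.
apply: contrapT => no.
have : chain N (fun s => Theta N (map lab s)) = 0.
  apply: chain0 => s Gs; apply: contrapT => /eqP ne; apply: no.
  by exists s => //; apply: Theta_alternating ne; rewrite size_map (G_size Gs).
by rewrite chain_Theta// => /eqP; rewrite signr_eq0.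
Qed.

End KyFan.

(** * Masses of labelings *)

Section FiniteMeasure.
Context d (T : measurableType d) (R : realType).
Variable mu : {finite_measure set T -> \bar R}.

Definition mass (A : set T) : R := fine (mu A).

Lemma massE A : measurable A -> mu A = (mass A)%:E.
Proof. by move=> mA; rewrite fineK// fin_num_measure. Qed.

Lemma mass_ge0 A : 0 <= mass A.
Proof. by rewrite fine_ge0. Qed.

Lemma mass0 : mass set0 = 0.
Proof. by rewrite /mass measure0. Qed.

Lemma le_mass A B : measurable A -> measurable B -> A `<=` B -> mass A <= mass B.
Proof.
by move=> mA mB AB; rewrite -lee_fin -!massE// le_measure ?inE.
Qed.

Lemma massU A B : measurable A -> measurable B -> mass (A `|` B) <= mass A + mass B.
Proof.
move=> mA mB; rewrite -lee_fin EFinD -!massE//; first exact: measureU2.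
exact: measurableU.
Qed.

Lemma massD A B : measurable A -> measurable B -> B `<=` A ->
  mass (A `\` B) = mass A - mass B.
Proof.
move=> mA mB BA; apply: EFin_inj; rewrite EFinB -!massE//; last exact: measurableD.
by rewrite measureD// ?setIidr// ltey_eq fin_num_measure.
Qed.

Variable h : T -> R.
Hypothesis mh : measurable_fun setT h.

Lemma measurable_sublevel c : measurable [set y | h y < c].
Proof.
have := mh measurableT (measurable_itv `]-oo, c[).
by rewrite setTI; congr measurable; apply/seteqP; split => y /=; rewrite in_itv.
Qed.

Lemma measurable_level c : measurable [set y | h y = c].
Proof. by have := mh measurableT (measurable_set1 c); rewrite setTI. Qed.

Definition mass_below c : R := mass [set y | h y < c].

Lemma le_mass_below a b : a <= b -> mass_below a <= mass_below b.
Proof.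
move=> ab; apply: le_mass => [||y /= /lt_le_trans]; try exact: measurable_sublevel.
exact.
Qed.

Hypothesis h_diffuse : forall c, mu [set y | h y = c] = 0%E.

(** Continuity of the measure gives the left limit along c - 1/(n+1) and the right limit along c +
    1/(n+1); the latter is the mass of h <= c, equal to that of h < c because level sets are null.
    Monotonicity does the rest. *)
Lemma continuous_mass_below : continuous mass_below.
Proof.
move=> c.
pose u (n : nat) : R := n.+1%:R^-1.
have u0 n : 0 < u n by rewrite invr_gt0.
have u_dec m n : (m <= n)%N -> u n <= u m.
  by move=> mn; rewrite lef_pV2 ?posrE// ler_nat.
have u_small x : 0 < x -> exists n, u n < x.
  move=> x0; exists (Num.trunc x^-1).
  by rewrite invf_plt ?posrE// truncnS_gt.
have msub := measurable_sublevel.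
have bigcupE : \bigcup_n [set y | h y < c - u n] = [set y | h y < c].
  apply/seteqP; split => y.
    by move=> [n _ /= /lt_le_trans]; apply; rewrite gerBl ltW.
  move=> /= hy; have [|n un] := u_small (c - h y); first by rewrite subr_gt0.
  by exists n => //=; rewrite ltrBrDl -ltrBrDr.
have bigcapE : \bigcap_n [set y | h y < c + u n] = [set y | h y <= c].
  apply/seteqP; split => y /=.
    move=> H; rewrite leNgt; apply/negP => hy.
    have [|n un] := u_small (h y - c); first by rewrite subr_gt0.
    by have /= := H n I; rewrite ltNge => /negP; apply; rewrite -lerBrDl ltW.
  by move=> hy n _ /=; rewrite (le_lt_trans hy)// ltrDl.
have mle : measurable [set y | h y <= c].
  by rewrite -bigcapE; apply: bigcapT_measurable => n; exact: msub.
have leE : mu [set y | h y <= c] = mu [set y | h y < c].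
  have -> : [set y | h y <= c] = [set y | h y < c] `|` [set y | h y = c].
    apply/seteqP; split => y /=; rewrite le_eqVlt.
      by move=> /orP[/eqP|]; [right|left].
    by move=> [->|->]; rewrite ?orbT ?eqxx.
  apply: (null_setU _ (measurable_level c)).1; last exact: msub.
  exact: (measure0_null_setP mu (measurable_level c)).2 (h_diffuse c).
have cvgl : mass_below (c - u n) @[n --> \oo] --> mass_below c.
  have := @nondecreasing_cvg_mu _ T R mu (fun n => [set y | h y < c - u n])
    (fun n => msub _).
  rewrite bigcupE => /(_ (msub _)) H.
  apply: fine_cvg; rewrite -/(mass_below c) -massE//; apply: H.
  apply/nondecreasing_seqP => n; apply/subsetPset => y /= /lt_le_trans; apply.
  by rewrite lerD2l lerN2 u_dec.
have cvgr : mass_below (c + u n) @[n --> \oo] --> mass_below c.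
  have := @nonincreasing_cvg_mu _ T R mu (fun n => [set y | h y < c + u n]).
  rewrite bigcapE => H.
  apply: fine_cvg; rewrite -/(mass_below c) -massE// -leE; apply: H => //.
  - by rewrite ltey_eq fin_num_measure.
  apply/nonincreasing_seqP => n; apply/subsetPset => y /= /lt_le_trans; apply.
  by rewrite lerD2l u_dec.
apply/cvgrPdist_lt => e e0.
have [n nl] : exists n, mass_below c - mass_below (c - u n) < e.
  have /cvgrPdist_lt/(_ _ e0)[n _ /(_ n (leqnn n)) /=] := cvgl.
  by move=> /(le_lt_trans (ler_norm _)); exists n.
have [m ml] : exists m, mass_below (c + u m) - mass_below c < e.
  have /cvgrPdist_lt/(_ _ e0)[m _ /(_ m (leqnn m)) /=] := cvgr.
  by rewrite distrC => /(le_lt_trans (ler_norm _)); exists m.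
near=> x.
have xn : c - u n <= x.
  by apply: ltW; near: x; apply: lt_nbhsr; rewrite ltrBlDr ltrDl.
have xm : x <= c + u m.
  by apply: ltW; near: x; apply: lt_nbhsl; rewrite ltrDl.
have := le_mass_below xn; have := le_mass_below xm.
rewrite ltr_norml; move: nl ml; lra.
Unshelve. all: by end_near.
Qed.

End FiniteMeasure.

Lemma continuous_of_modulus (R : realFieldType) (U : topologicalType)
    (f : U -> R) (S : U -> U -> R) :
  (forall x, continuous (S x)) -> (forall x, S x x = 0) ->
  (forall x y, `|f x - f y| <= S x y) -> continuous f.
Proof.
move=> cS S0 fS x; apply/cvgrPdist_lt => e e0.
have /cvgrPdist_lt/(_ _ e0) := cS x x.
rewrite S0; apply: filterS => y /=; rewrite sub0r normrN.
by move=> /(le_lt_trans (ler_norm _)); apply: le_lt_trans.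
Qed.

Section DecisionList.
Variables (F : zmodType) (T : Type) (R : realType) (h : nat -> T -> R).

(* A decision list: the cut of index i - 1 has the highest priority. *)
Fixpoint decide (g : nat -> F) (b : nat -> bool) (i : nat) : F :=
  if i is i'.+1 then if b i' then g i'.+1 else decide g b i' else g 0%N.

Definition labeling (g : nat -> F) (c : nat -> R) (i : nat) (y : T) : F :=
  decide g (fun l => h l y < c l) i.

Lemma eq_labeling g g' c c' i :
  (forall l, (l <= i)%N -> g l = g' l) -> (forall l, (l < i)%N -> c l = c' l) ->
  labeling g c i = labeling g' c' i.
Proof.
move=> gg cc; apply/funext => y; rewrite /labeling.
elim: i gg cc => [|i IH] gg cc /=; first exact: gg.
rewrite gg// cc// IH// => l li; [apply: gg|apply: cc]; lia.
Qed.

Lemma labelingD g c i a y :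
  labeling (fun l => g l + a) c i y = labeling g c i y + a.
Proof. by rewrite /labeling; elim: i => //= i ->; case: ifP. Qed.

Lemma labelingS g c i y :
  labeling g c i.+1 y = if h i y < c i then g i.+1 else labeling g c i y.
Proof. by []. Qed.

End DecisionList.

Section LabelingMass.
Context d (T : measurableType d) (R : realType) (F : finZmodType).
Variables (mu : {finite_measure set T -> \bar R}) (h : nat -> T -> R).
Hypothesis mh : forall l, measurable_fun setT (h l).
Implicit Types (g : nat -> F) (c : nat -> R) (x : T -> F).

Definition label_mass x (a : F) : R := mass mu [set y | x y = a].

Let below l := mass_below mu (h l).

Lemma measurable_labeling g c i a : measurable [set y | labeling h g c i y = a].
Proof.
elim: i => [|i IH].
  rewrite (_ : mkset _ = if g 0%N == a then setT else set0); first by case: ifP.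
  apply/seteqP; rewrite /labeling /=; split => y /=; first by move=> ->; rewrite eqxx.
  by case: eqP.
have mb := measurable_sublevel (mh i) (c i).
rewrite (_ : mkset _ = (if g i.+1 == a then [set y | h i y < c i] else set0) `|`
   ([set y | labeling h g c i y = a] `\` [set y | h i y < c i])).
  by apply: measurableU; [case: ifP|apply: measurableD].
apply/seteqP; split => y /=; rewrite labelingS.
  case: ifP => [hy <-|/negbT hy <-]; first by left; rewrite eqxx.
  by right; split => //; apply/negP.
by move=> [|[<-] /negP/negbTE ->]//; case: eqP => //= <- ->.
Qed.

(** Labels can change only where some [h l y] lies between the thresholds [c l] and [c' l]; [D] is
    the union of these strips. *)
Lemma labeling_change g c c' i : exists D, [/\ measurable D,
  (forall y, ~ D y -> labeling h g c i y = labeling h g c' i y) &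
  mass mu D <= \sum_(l < i) `|below l (c l) - below l (c' l)|].
Proof.
elim: i => [|i [D [mD Dxx le]]].
  by exists set0; split => //; rewrite mass0 big_ord0.
wlog cc : c c' Dxx le / c i <= c' i.
  move=> H; have [/H|/ltW cc] := leP (c i) (c' i); first exact.
  have [||//|D' [mD' Dxx' le']] := H c' c.
  - by move=> y /Dxx.
  - by apply: le_trans le _; apply: ler_sum => l _; rewrite distrC.
  exists D'; split => //; first by move=> y /Dxx'.
  by apply: le_trans le' _; apply: ler_sum => l _; rewrite distrC.
pose E := [set y | h i y < c' i] `\` [set y | h i y < c i].
have ms := measurable_sublevel (mh i).
have mE : measurable E by apply: measurableD.
exists (D `|` E); split; first exact: measurableU.
  move=> y /not_orP[/Dxx Dy nE]; rewrite !labelingS Dy.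
  have [hc|hc] := ltP (h i y) (c i); first by rewrite (lt_le_trans hc cc).
  by have [hc'|//] := ltP (h i y) (c' i); case: nE; split => //=; rewrite ltNge hc.
rewrite big_ord_recr /= (le_trans (massU _ _ _))// lerD// massD//.
  by rewrite distrC ler_norm.
by move=> y /= /lt_le_trans; apply.
Qed.

Lemma label_mass_close g c c' i a :
  `|label_mass (labeling h g c i) a - label_mass (labeling h g c' i) a| <=
  \sum_(l < i) `|below l (c l) - below l (c' l)|.
Proof.
have [D [mD Dxx le]] := labeling_change g c c' i; apply: le_trans le.
rewrite /label_mass; set A := [set _ | _]; set B := [set _ | _].
have mA : measurable A by apply: measurable_labeling.
have mB : measurable B by apply: measurable_labeling.
have AB : mass mu A <= mass mu B + mass mu D.
  apply: le_trans (massU _ mB mD); apply: le_mass => //; first exact: measurableU.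
  by move=> y Ay; have [|/Dxx E] := pselect (D y); [right|left; rewrite /B /= -E].
have BA : mass mu B <= mass mu A + mass mu D.
  apply: le_trans (massU _ mA mD); apply: le_mass => //; first exact: measurableU.
  by move=> y Ay; have [|/Dxx E] := pselect (D y); [right|left; rewrite /A /= E].
by rewrite ler_norml; move: AB BA; lra.
Qed.

Hypothesis h_diffuse : forall l r, mu [set y | h l y = r] = 0%E.

Lemma continuous_label_mass N g a :
  continuous (fun c : 'rV[R]_N => label_mass (labeling h g
    (fun l => if insub l is Some i then c 0 i else 0) N) a).
Proof.
pose S (c c' : 'rV[R]_N) := \sum_(l < N) `|below l (c 0 l) - below l (c' 0 l)|.
apply: (continuous_of_modulus (S := S)) => [c|c|c c'].
- apply: continuous_big => [|l _ c'].
    exact: add_continuous.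
  have cl : below l (c'' 0 l) @[c'' --> c'] --> below l (c' 0 l).
    apply: (continuous_comp (f := fun c' : 'rV[R]_N => c' 0 l) (g := below l)).
      exact: coord_continuous.
    exact: continuous_mass_below.
  exact: (cvg_norm (cvgB (cvg_cst _) cl)).
- by apply: big1 => l _; rewrite subrr normr0.
apply: le_trans (label_mass_close _ _ _ _ _) _.
by apply: ler_sum => l _; rewrite !valK.
Qed.

End LabelingMass.

(** The points are evenly spaced in the value of f, by the intermediate value theorem, which avoids
    any modulus of continuity. *)
Lemma continuous_grid (R : realType) (f : R -> R) (a b : R) (M : nat) :
  a <= b -> continuous f -> f a <= f b -> (0 < M)%N ->
  exists c : nat -> R, [/\ c 0%N = a, c M = b, forall k, a <= c k <= b &
    forall k, (k < M)%N -> `|f (c k) - f (c k.+1)| <= (f b - f a) / M%:R].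
Proof.
move=> ab cf fab M0.
have M0' : 0 < M%:R :> R by rewrite ltr0n.
have D0 : 0 <= f b - f a by rewrite subr_ge0.
pose v k := f a + (f b - f a) * (k%:R / M%:R).
(* The ends are imposed: f may take the value f a or f b at other points too. *)
have ivt k : exists c, (k <= M)%N -> [/\ a <= c <= b, f c = v k,
    (k = 0%N -> c = a) & (k = M -> c = b)].
  have [->|k0] := eqVneq k 0%N.
    exists a => _; split => //; first by rewrite lexx ab.
      by rewrite /v mul0r mulr0 addr0.
    by move=> M00; rewrite -M00 in M0.
  have [->|kM] := eqVneq k M.
    exists b => _; split => //; first by rewrite lexx ab.
      by rewrite /v divff ?gt_eqF// mulr1 addrCA subrr addr0.
    by move=> M00; rewrite M00 in M0.
  have [kM'|] := leqP k M; last by exists a.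
  have [||c cab fc] := @IVT R f a b (v k) ab.
  - exact: continuous_subspaceT.
  - rewrite min_l// max_r// lerDl mulr_ge0 ?divr_ge0//=.
    rewrite /v -lerBrDl ler_piMr// ler_pdivrMr// mul1r ler_nat//.
  exists c => _; split => //.
    by move=> E; rewrite E eqxx in k0.
  by move=> E; rewrite E eqxx in kM.
have [c cP] := choice ivt.
exists (fun k => if (k <= M)%N then c k else a); split.
- by have [_ _ ->] := cP 0%N (leq0n _).
- by rewrite leqnn; have [_ _ _ ->] := cP M (leqnn _).
- move=> k; case: ifP => [kM|_]; last by rewrite lexx ab.
  by have [] := cP _ kM.
move=> k kM; rewrite kM (ltnW kM).
have [_ -> _ _] := cP _ kM; have [_ -> _ _] := cP _ (ltnW kM).
rewrite /v -natr1 (_ : _ - _ = - ((f b - f a) / M%:R)); last by field; rewrite gt_eqF.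
by rewrite normrN ger0_norm// divr_ge0.
Qed.

Section Deviation.
Context d (T : measurableType d) (R : realType) (F : finZmodType) (t : nat).
Variables (mu : 'I_t -> {finite_measure set T -> \bar R}) (h : nat -> T -> R).
Hypothesis mh : forall l, measurable_fun setT (h l).
Hypothesis h_diffuse : forall j l r, mu j [set y | h l y = r] = 0%E.
Variable N : nat.

Definition fair (x : T -> F) :=
  forall j a b, label_mass (mu j) x a = label_mass (mu j) x b.

(** For each of the finitely many label sequences, the total unfairness is continuous and positive
    on a compact box of thresholds, hence bounded below there. *)
Lemma exists_deviation :
  ~ (exists (g : nat -> F) (c : nat -> R), (forall l, -1 <= c l <= 1) /\ fair (labeling h g c N)) ->
  exists2 e : R, 0 < e & forall (g : nat -> F) (c : nat -> R), (forall l, -1 <= c l <= 1) ->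
    exists j a b, e <= label_mass (mu j) (labeling h g c N) a -
                       label_mass (mu j) (labeling h g c N) b.
Proof.
move=> unfair.
pose gx (g : {ffun 'I_N.+1 -> F}) l := g (inord l).
pose cx (c : 'rV[R]_N) l := if insub l is Some i then c 0 i else 0.
pose K := ('I_t * F * F)%type.
pose m g c j a := label_mass (mu j) (labeling h (gx g) (cx c) N) a.
pose D g c := \sum_(k : K) `|m g c k.1.1 k.1.2 - m g c k.1.1 k.2|.
pose box := [set c : 'rV[R]_N | forall i, c 0 i \in `[(-1 : R), 1]].
have box_in c : box c -> forall l, -1 <= cx c l <= 1.
  move=> bc l; rewrite /cx; case: insub => [i|]; last by rewrite lerN10 ler01.
  by have := bc i; rewrite in_itv.
have Dpos g c : box c -> 0 < D g c.
  move=> bc; rewrite lt_neqAle sumr_ge0 ?andbT//; apply/eqP => /esym D0.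
  apply: unfair; exists (gx g), (cx c); split; first exact: box_in.
  move=> j a b; apply/eqP; rewrite -subr_eq0 -normr_eq0; apply/eqP.
  have ge0 (k : K) : true -> 0 <= `|m g c k.1.1 k.1.2 - m g c k.1.1 k.2| by [].
  exact: psumr_eq0P ge0 D0 (j, a, b) isT.
have min g : exists e, 0 < e /\ forall c, box c -> e <= D g c.
  have [|||c cb cmin] := @EVT_min_rV R N (D g) box.
  - by exists 0 => i; rewrite mxE in_itv /= lerN10 ler01.
  - apply: (@rV_compact R N (fun=> `[(-1), 1]%classic)) => _.
    exact: segment_compact.
  - apply: continuous_subspaceT; apply: continuous_big => [|k _ c].
      exact: add_continuous.
    have cm a : continuous (fun c => m g c k.1.1 a).
      exact: continuous_label_mass.
    exact: (cvg_norm (cvgB (cm k.1.2 c) (cm k.2 c))).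
  exists (D g c); rewrite inE in cb; split; first exact: Dpos.
  by move=> c' bc'; apply: cmin; rewrite inE.
have [e eP] := choice min.
pose e1 := \big[Num.min/1]_g e g.
have e10 : 0 < e1.
  by apply: lt_bigmin => // g _; have [] := eP g.
have le1 g : e1 <= e g by exact: bigmin_le.
(* If every difference were below this, their sum over [K] would be below [e1]; the successor makes
   this strict. *)
exists (e1 / #|{: K}|.+1%:R); first by rewrite divr_gt0.
move=> g c cin; apply: contrapT => no.
have {}no (k : K) : `|m [ffun l : 'I_N.+1 => g l] (\row_i c i) k.1.1 k.1.2 -
    m [ffun l : 'I_N.+1 => g l] (\row_i c i) k.1.1 k.2| <= e1 / #|{: K}|.+1%:R.
  have E : labeling h (gx [ffun l : 'I_N.+1 => g l]) (cx (\row_i c i)) N =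
      labeling h g c N.
    apply: eq_labeling => l lN; first by rewrite /gx ffunE inordK.
    by rewrite /cx insubT mxE.
  rewrite /m E; case: k => -[j a] b /=; rewrite ler_norml lerNl opprB.
  by apply/andP; split; apply/ltW; rewrite ltNge; apply/negP => H; apply: no;
    [exists j, b, a|exists j, a, b].
have : D [ffun l : 'I_N.+1 => g l] (\row_i c i) <= e1 * (#|{: K}|%:R / #|{: K}|.+1%:R).
  apply: le_trans (ler_sum _ (fun k _ => no k)) _.
  by rewrite sumr_const -[leLHS]mulr_natr mulrAC -mulrA.
apply/negP; rewrite -ltNge; apply: lt_le_trans (le_trans (le1 _) ((eP _).2 _ _)).
  by rewrite gtr_pMr// ltr_pdivrMr// mul1r ltr_nat.
by move=> i; rewrite mxE in_itv; apply: cin.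
Qed.

End Deviation.

(** The lower bound [L] will witness that all members are nonempty, the upper bound [U] that all lie
    in one grid cell. *)
Fixpoint flag (X : Type) (L : set X) (s : seq (set X)) (U : set X) : Prop :=
  if s is A :: s' then L `<=` A /\ flag A s' U else L `<=` U.

Lemma map_flag (X Y : Type) (f : set X -> set Y) :
  {homo f : A B / A `<=` B} ->
  forall L s U, flag L s U -> flag (f L) (map f s) (f U).
Proof.
move=> fh L s U; elim: s L => [|A s IH] L /=; first exact: fh.
by move=> [/fh ? /IH].
Qed.

(** * Fair splittings into a prime number of pieces *)

Section Flags.
Variable X : Type.
Implicit Types (A B L U : set X) (s : seq (set X)).

Lemma flag_sub L s U : flag L s U -> L `<=` U.
Proof. by elim: s L => //= A s IH L [LA /IH]; apply: subset_trans. Qed.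

Lemma eq_map_flag (Y : Type) (f g : set X -> Y) L s U : flag L s U ->
  (forall A, L `<=` A -> A `<=` U -> f A = g A) -> map f s = map g s.
Proof.
elim: s L => //= A s IH L [LA As] fg; rewrite fg//; last exact: flag_sub As.
congr cons; apply: IH As _ => B AB BU; apply: fg => //.
exact: subset_trans AB.
Qed.

Lemma prism_flag (v e : set X -> set X) : {homo v : A B / A `<=` B} ->
  {homo e : A B / A `<=` B} -> (forall A, v A `<=` e A) ->
  forall L s1 A s2 U, flag L (s1 ++ A :: s2) U ->
  flag (v L) (map v s1 ++ v A :: e A :: map e s2) (e U).
Proof.
move=> vh eh ve L s1 A s2 U; elim: s1 L => [|B s1 IH] L /= [/vh LA].
  by move=> /(map_flag eh).
by move=> /IH.
Qed.

(** Each change of label forces a strict increase of the rank. *)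
Lemma flag_rank (K : eqType) (r : set X -> nat) (l : set X -> K) :
  (forall A B, A `<=` B -> (r A <= r B)%N) ->
  (forall A B, A `<=` B -> r A = r B -> l A = l B) ->
  forall L s U, flag L s U -> path (fun a b => a != b) (l L) (map l s) ->
  (r L + size s <= r U)%N.
Proof.
move=> rle rl L s U; elim: s L => [|A s IH] L /=; first by move=> /rle; rewrite addn0.
move=> [LA /IH H] /andP[ne /H]; apply: leq_trans.
rewrite addnS -addSn leq_add2r ltn_neqAle rle// andbT.
by apply: contraNneq ne => /(rl _ _ LA) ->.
Qed.

End Flags.

Section Mean.
Variables (p : nat) (p_pr : prime p).

(* Division by #|C|, invertible because p is prime, makes [mean] equivariant. *)
Definition mean (C : {set 'F_p}) : 'F_p := (\sum_(a in C) a) / #|C|%:R.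

Lemma mean_translate (C : {set 'F_p}) b : (0 < #|C| < p)%N ->
  mean [set a + b | a in C]%SET = mean C + b.
Proof.
move=> /andP[C0 Cp]; rewrite /mean.
have C0' : #|C|%:R != 0 :> 'F_p.
  by rewrite -(dvdn_pcharf (pchar_Fp p_pr)) gtnNdvd.
rewrite card_imset; last exact: addIr.
rewrite big_imset /=; last by move=> x y _ _; apply: addIr.
rewrite big_split /= sumr_const mulrDl; congr (_ + _).
by rewrite -[b *+ _]mulr_natr mulfK.
Qed.

End Mean.

Section FairPrime.
Context d (T : measurableType d) (R : realType) (p t : nat).
Hypothesis p_pr : prime p.
Variables (mu : 'I_t -> {finite_measure set T -> \bar R}) (h : nat -> T -> R).
Hypothesis mh : forall l, measurable_fun setT (h l).
Hypothesis h_itv : forall l y, -1 < h l y < 1.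
Hypothesis h_diffuse : forall j l r, mu j [set y | h l y = r] = 0%E.

Local Notation X := (T -> 'F_p).
Implicit Types (x : X) (A B L U : set X) (s : seq (set X)).

Let m j x a := label_mass (mu j) x a.
Let N := (t * p.-1)%N.
Let below j l := mass_below (mu j) (h l).
Let below_sum l r := \sum_j below j l r.
Let total := \sum_j mass (mu j) setT.

Let below_sumN1 l : below_sum l (-1) = 0.
Proof.
apply: big1 => j _; rewrite /below /mass_below (_ : mkset _ = set0) ?mass0//.
apply/seteqP; split => y //= hy; have /andP[hy' _] := h_itv l y.
by have := lt_trans hy hy'; rewrite ltxx.
Qed.

Let below_sum1 l : below_sum l 1 = total.
Proof.
apply: eq_bigr => j _; rewrite /below /mass_below; congr mass.
by apply/seteqP; split => y //= _; have /andP[] := h_itv l y.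
Qed.

Let continuous_below_sum l : continuous (below_sum l).
Proof.
apply: continuous_big => [|j _]; first exact: add_continuous.
exact: continuous_mass_below.
Qed.

(** All the [below j l] are nondecreasing, so their increments add up without cancellation: a grid
    fine for the sum is fine for every measure. *)
Let below_dominated j l a b :
  `|below j l a - below j l b| <= `|below_sum l a - below_sum l b|.
Proof.
wlog ab : a b / a <= b.
  move=> H; have [/H//|/ltW/H] := leP a b.
  by rewrite distrC [leRHS]distrC.
have le j' : 0 <= below j' l b - below j' l a.
  by rewrite subr_ge0; apply: le_mass_below.
rewrite distrC [leRHS]distrC -sumrB ger0_norm// ger0_norm ?sumr_ge0//.
by rewrite (bigD1 j)//= lerDl sumr_ge0.
Qed.

(** * Labels and ranks of the cells of a fine grid *)

Section FineGrid.
Variables (M : nat) (c : nat -> nat -> R) (e : R).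
Hypothesis M0 : (0 < M)%N.
Hypothesis c0 : forall l, c l 0%N = -1.
Hypothesis cM : forall l, c l M = 1.
Hypothesis c_itv : forall l k, -1 <= c l k <= 1.
Hypothesis c_fine : forall l k, (k < M)%N ->
  `|below_sum l (c l k) - below_sum l (c l k.+1)| <= total / M%:R.
Hypothesis e_dev : forall (g : nat -> 'F_p) (r : nat -> R),
  (forall l, -1 <= r l <= 1) ->
  exists j a b, e <= m j (labeling h g r N) a - m j (labeling h g r N) b.
Hypothesis e_big : (total / M%:R *+ N) *+ 2 < e.

(** [u] selects a grid cell: the threshold of each cut is one of the two ends of its grid
    interval. *)
Let fine_label (g : nat -> 'F_p) (u : nat -> nat) (i : nat) x := exists w : nat -> nat,
  (forall l, w l = u l \/ w l = (u l).+1) /\ x = labeling h g (fun l => c l (w l)) i.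

Let fine_set i U := exists g u, (forall l, (u l < M)%N) /\ U `<=` fine_label g u i.

Let spread j x := exists a b, e <= m j x a - m j x b.

(* The labels of maximal mass for mu_j at some point of A that is unfair for
   mu_j. *)
Let col A j : {set 'F_p} :=
  finset (fun a => `[< exists2 x, A x & spread j x /\ forall b, m j x b <= m j x a >]).

Let rank A := (\sum_j #|col A j|)%N.

(** The choice of j depends only on which sets [col A j] are empty, which [act] does not change; the
    mean then makes the label equivariant. *)
Let lab A : 'F_p :=
  if [pick j | (0 < #|col A j|)%N] is Some j then mean (col A j) else 0.

Let colS A B j : A `<=` B -> col A j \subset col B j.
Proof.
move=> AB; apply/fintype.subsetP => a; rewrite !finset.in_set => /asboolP[x Ax H].
by apply/asboolP; exists x => //; exact: AB.
Qed.

Let rankS A B : A `<=` B -> (rank A <= rank B)%N.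
Proof. by move=> AB; apply: leq_sum => j _; apply: subset_leq_card (colS _ AB). Qed.

(** Equal sums of termwise ordered cardinalities are termwise equal, and nested sets of equal
    cardinality coincide. *)
Let rank_lab A B : A `<=` B -> rank A = rank B -> lab A = lab B.
Proof.
move=> AB rAB.
have le j : true -> (#|col A j| <= #|col B j| ?= iff (#|col A j| == #|col B j|))%N.
  by move=> _; split => //; apply/subset_leq_card/colS.
have colE j : col A j = col B j.
  have [_ /esym] := leqif_sum le; rewrite -/(rank A) -/(rank B) rAB eqxx.
  move=> /forallP/(_ j)/implyP/(_ isT)/eqP cAB.
  by apply/eqP; rewrite eqEcard colS//= cAB.
rewrite /lab (eq_pick (Q := fun j => (0 < #|col B j|)%N)) => [|j]; last by rewrite /= colE.
by case: pickP => // j _; rewrite colE.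
Qed.

Let act A : set X := [set (fun y => x y + 1) | x in A].

Let col_act A j : col (act A) j = [set a + 1 | a in col A j]%SET.
Proof.
have mE x a : m j (fun y => x y + 1) (a + 1) = m j x a.
  by congr mass; apply/seteqP; split => y /=; [move=> /addIr|move=> ->].
have mB x a : m j x (a - 1) = m j (fun y => x y + 1) a by rewrite -mE subrK.
apply/setP => a; apply/idP/imsetP => [|[b + ->{a}]].
  rewrite finset.in_set => /asboolP[_ [x Ax <-] [[b [b' bb']] amax]].
  exists (a - 1); rewrite ?subrK// finset.in_set; apply/asboolP; exists x => //; split.
    by exists (b - 1), (b' - 1); rewrite !mB.
  by move=> b''; rewrite mB -mE; apply: amax.
rewrite !finset.in_set => /asboolP[x Ax [[a [a' aa']] bmax]]; apply/asboolP.
exists (fun y => x y + 1); first by exists x.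
split; first by exists (a + 1), (a' + 1); rewrite !mE.
by move=> b'; rewrite mE -mB.
Qed.

Let lab_act A : (forall j, #|col A j| < p)%N -> (0 < rank A)%N -> lab (act A) = lab A + 1.
Proof.
move=> ltp rA.
have cE j : #|col (act A) j| = #|col A j|.
  by rewrite col_act card_imset//; apply: addIr.
rewrite /lab (eq_pick (Q := fun j => (0 < #|col A j|)%N)) => [|j]; last by rewrite /= cE.
case: pickP => [j j0|none]; first by rewrite col_act mean_translate// j0 ltp.
by move: rA; rewrite /rank big1// => j _; apply/eqP; rewrite -leqn0 leqNgt none.
Qed.

Let fine_act i A : fine_set i A -> fine_set i (act A).
Proof.
move=> [g [u [uM Ag]]]; exists (fun l => g l + 1), u; split => // _ [x /Ag[w [wu ->]] <-].
by exists w; split => //; apply/funext => y; rewrite labelingD.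
Qed.

(** Within a grid cell each of the at most N cuts moves by at most one grid step, of mass at most
    [total / M]. *)
Let fine_close i U x x' j a : (i <= N)%N -> fine_set i U -> U x -> U x' ->
  m j x a - m j x' a <= total / M%:R *+ N.
Proof.
move=> iN [g [u [uM Ug]]] /Ug[w [wu ->]] /Ug[w' [wu' ->]].
apply: le_trans (ler_norm _) _; apply: le_trans (label_mass_close _ _ _ _ _ _ _) _ => //.
have total0 : 0 <= total / M%:R by rewrite divr_ge0// sumr_ge0// => j' _; apply: mass_ge0.
apply: (@le_trans _ _ (total / M%:R *+ i)); last by rewrite ler_wpMn2l.
rewrite -[in leRHS](card_ord i) -sumr_const; apply: ler_sum => l _.
apply: le_trans (below_dominated _ _ _ _) _.
have := c_fine l (uM l).
by case: (wu l) => ->; case: (wu' l) => -> //; rewrite ?subrr ?normr0// distrC.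
Qed.

(* If every label were maximal at some point of U, comparing the maximal points
   for a and b would make mu_j almost fair on the small set U. *)
Let fine_col i U j : (i <= N)%N -> fine_set i U -> (#|col U j| < p)%N.
Proof.
move=> iN Uf; rewrite ltnNge; apply/negP => pC.
have Call a : a \in col U j.
  suff -> : col U j = finset.setTfor 'F_p by rewrite inE.
  by apply/eqP; rewrite eqEcard finset.subsetT cardsT card_Fp.
have := Call 0; rewrite finset.in_set => /asboolP[x Ux [[a [b ab]] _]].
have := Call b; rewrite finset.in_set => /asboolP[x' Ux' [_ /(_ a) bmax]].
have := fine_close j a iN Uf Ux Ux'; have := fine_close j b iN Uf Ux' Ux.
move: e_big; rewrite mulr2n; move: (_ *+ N) => z; lra.
Qed.

(* A labeling with fewer than N cuts is one with N cuts, the last at -oo. *)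
Let labeling_stop (g : nat -> 'F_p) r i n : (i <= n)%N ->
  (forall l, (i <= l)%N -> r l = -1) -> labeling h g r n = labeling h g r i.
Proof.
move=> + ri; elim: n => [|n IH]; first by case: i {ri}.
rewrite leq_eqVlt => /orP[/eqP ->//|]; rewrite ltnS => ni.
rewrite -IH//; apply/funext => y; rewrite labelingS ri//.
have /andP[hy _] := h_itv n y.
by case: ltP => // /(lt_trans hy); rewrite ltxx.
Qed.

Let fine_rank i U x : (i <= N)%N -> fine_set i U -> U x -> (0 < rank U)%N.
Proof.
move=> iN [g [u [uM Ug]]] Ux; have [w [wu xE]] := Ug _ Ux.
(* The missing cuts are put at -1, where they label nothing, so that [e_dev] applies to [x]. *)
pose r l := if (l < i)%N then c l (w l) else -1.
have {}xE : x = labeling h g r N.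
  rewrite xE (@labeling_stop _ _ i)// => [|l il]; last by rewrite /r ltnNge il.
  by apply: eq_labeling => // l li; rewrite /r li.
have [|j [a [b ab]]] := e_dev g (r := r).
  by move=> l; rewrite /r; case: ifP => // _; rewrite lexx (le_trans (lerN10 R) ler01).
rewrite -xE in ab; rewrite /rank (bigD1 j)//= ltn_addr// card_gt0.
apply/finset.set0Pn; have [a' _ amax] := @arg_maxP _ _ _ (0 : 'F_p) xpredT (m j x) isT.
exists a'; rewrite finset.in_set; apply/asboolP; exists x => //; split; first by exists a, b.
by move=> b'; apply: amax.
Qed.

(** This is the cone: at [k = 0] it does nothing, at [k = M] it gives the constant labeling 0. The
    other labels of new cuts come from [act]. *)
Let cut i k x y := if h i y < c i k then 0 else x y.
Let cv i k A : set X := [set cut i k x | x in A].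
Let ce i k A : set X := cv i k A `|` cv i k.+1 A.

Let cv_start i A : cv i 0 A = A.
Proof.
rewrite -[RHS]image_id /cv; congr image; apply/funext => x; apply/funext => y.
rewrite /cut c0; have /andP[hy _] := h_itv i y.
by case: ltP => // /(lt_trans hy); rewrite ltxx.
Qed.

Let cv_end i A : A !=set0 -> cv i M A = [set cst 0].
Proof.
move=> [x0 Ax0]; have cutE x : cut i M x = cst 0.
  by apply/funext => y; rewrite /cut cM; have /andP[_ ->] := h_itv i y.
apply/seteqP; split => x /=; first by move=> [x' _ <-]; apply: cutE.
by move=> ->; exists x0.
Qed.

Let fine_prism i k U : (k < M)%N -> fine_set i U -> fine_set i.+1 (ce i k U).
Proof.
move=> kM [g [u [uM Ug]]].
exists (fun l => if (l <= i)%N then g l else 0), (fun l => if (l < i)%N then u l else k).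
split=> [l|x]; first by case: ifP.
have step k' x' : k' = k \/ k' = k.+1 -> U x' ->
    fine_label (fun l => if (l <= i)%N then g l else 0)
      (fun l => if (l < i)%N then u l else k) i.+1 (cut i k' x').
  move=> k'k /Ug[w [wu ->]].
  exists (fun l => if (l < i)%N then w l else k'); split.
    by move=> l; case: ifP.
  apply/funext => y; rewrite labelingS /cut !ltnn; congr (if _ then _ else _).
  by congr (_ y); apply: eq_labeling => l li; rewrite li.
by move=> [] [x' Ux' <-]; apply: step; auto.
Qed.

Let good i s := exists L U, [/\ L !=set0, flag L s U, fine_set i U & size s = i.+1].

Let cv_homo i k : {homo cv i k : A B / A `<=` B}.
Proof. by move=> A B; apply: image_subset. Qed.

Lemma fine_grid_contradiction : False.
Proof.
have p0 := prime_gt0 p_pr.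
have act_p A : iter p act A = A.
  have actE k : iter k act A = [set (fun y => x y + k%:R) | x in A].
    elim: k => [|k IH].
      rewrite -[LHS]image_id; congr image; apply/funext => x; apply/funext => y.
      by rewrite addr0.
    rewrite iterS IH /act image_comp; congr image; apply/funext => x.
    by apply/funext => y /=; rewrite -natr1 addrA.
  rewrite actE pchar_Fp_0// -[RHS]image_id; congr image; apply/funext => x.
  by apply/funext => y; rewrite addr0.
have act_homo : {homo act : A B / A `<=` B} by move=> A B; apply: image_subset.
have labE i s : (i < N)%N -> good i s -> map lab (map act s) = map (+%R^~ 1) (map lab s).
  move=> iN [L [U [[x Lx] LsU Uf _]]]; rewrite -!map_comp.
  apply: (eq_map_flag LsU) => A LA AU /=; apply: lab_act.
    by move=> j; apply: leq_ltn_trans (fine_col j (ltnW iN) Uf); apply/subset_leq_card/colS.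
  have Af : fine_set i A by case: Uf => g [u [uM Ug]]; exists g, u; split => // y /AU /Ug.
  by apply: (@fine_rank i A x) => //; [exact: ltnW|exact: LA].
have [] := @exists_alternating p p_pr (set X) act M cv ce [set cst 0]
  (fun=> [set cst 0]) good lab N act_p.
- exists [set cst 0], [set cst 0]; split => //=.
  + by exists (cst 0).
  + by split; apply: subset_refl.
  exists (cst 0), (cst 0%N); split => // x ->; exists (cst 0%N); split => //.
  by move=> l; left.
- by move=> i s [L [U []]].
- move=> i s [L [U [[x Lx] LsU Uf ss]]]; exists (act L), (act U); split.
  + by exists (fun y => x y + 1), x.
  + exact: map_flag.
  + exact: fine_act.
  + by rewrite size_map.
- by move=> i s _; rewrite -[RHS]map_id; apply: eq_map => A; apply: cv_start.
- move=> i s [L [U [[x Lx] LsU _ <-]]].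
  rewrite (eq_map_flag (g := fun=> [set cst 0]) LsU).
    by elim: (s) => //= A s' ->.
  by move=> A LA _; apply: cv_end; exists x; apply: LA.
- move=> i s1 A s2 k k' [L [U [[x Lx] LsU Uf ss]]] kM k'k.
  exists (cv i k' L), (ce i k U); split.
  + by exists (cut i k' x), x.
  + apply: prism_flag LsU => [||B].
    * exact: cv_homo.
    * by move=> B C BC; apply: setUSS; apply: cv_homo.
    * by case: k'k => ->; [left|right].
  + exact: fine_prism.
  + by move: ss; rewrite !size_cat /= !size_map; lia.
- exact: labE.
(* The first cell has rank at least 1 and the rank then increases N times, beyond the bound N = t(p
   - 1) on the rank of [U]. *)
move=> [|A s]; first by move=> [L [U []]].
move=> [L [U [[x Lx] [LA AsU] Uf [sN]]]] alt.
have := flag_rank rankS rank_lab AsU alt.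
rewrite sN.
have rA : (0 < rank A)%N.
  apply: (@fine_rank N A x) => //; last exact: LA.
  by case: Uf => g [u [uM Ug]]; exists g, u; split => // y /(flag_sub AsU)/Ug.
have rU : (rank U <= N)%N.
  apply: (@leq_trans (\sum_(j < t) p.-1)); last by rewrite sum_nat_const card_ord.
  by apply: leq_sum => j _; rewrite -ltnS prednK//; apply: fine_col Uf.
by move: rA rU; lia.
Qed.

End FineGrid.

Lemma fair_prime :
  exists (g : nat -> 'F_p) (r : nat -> R),
    fair mu (labeling h g r (t * p.-1)).
Proof.
apply: contrapT => unfair.
have [|e e0 edev] := @exists_deviation _ T R 'F_p t mu h mh h_diffuse N.
  by move=> [g [r [_ gr]]]; apply: unfair; exists g, r.
(* With this many grid steps, 2N steps of mass [total / M] stay below [e]. *)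
pose M := (Num.trunc (total *+ N *+ 2 / e)).+1.
have M0 : 0 < M%:R :> R by rewrite ltr0n.
have total0 : 0 <= total by apply: sumr_ge0 => j _; apply: mass_ge0.
have grid l : exists c : nat -> R, [/\ c 0%N = -1, c M = 1, forall k, -1 <= c k <= 1 &
    forall k, (k < M)%N -> `|below_sum l (c k) - below_sum l (c k.+1)| <= total / M%:R].
  have [|||//|c [c0 cM c1 cf]] := @continuous_grid R (below_sum l) (-1) 1 M.
  - exact: le_trans (lerN10 R) ler01.
  - exact: continuous_below_sum.
  - by rewrite below_sumN1 below_sum1.
  by exists c; split => // k /cf; rewrite below_sumN1 below_sum1 subr0.
have [c cP] := choice grid.
apply: (@fine_grid_contradiction M c e) => //.
- by move=> l; have [] := cP l.
- by move=> l; have [] := cP l.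
- by move=> l; have [] := cP l.
- by move=> l; have [] := cP l.
- rewrite -!mulrnAl ltr_pdivrMr// mulrC -ltr_pdivrMr//.
  by rewrite truncnS_gt.
Qed.

End FairPrime.

Lemma sum_mass_fibers d (T : measurableType d) (R : realType)
    (mu : {finite_measure set T -> \bar R}) n (x : T -> 'I_n) :
  (forall a, measurable [set y | x y = a]) ->
  \sum_a mass mu [set y | x y = a] = mass mu setT.
Proof.
move=> mx; apply: EFin_inj; rewrite -massE// -sumEFin.
under eq_bigr do rewrite -massE//.
have cover : \big[setU/set0]_(a < n) [set y | x y = a] = setT.
  by apply/seteqP; split => y // _; rewrite (bigD1 (x y))//=; left.
rewrite -cover measure_semi_additive_ord// ?cover//.
by move=> a b _ _ [y [/= <- <-]].
Qed.

Lemma card_eq_bijective (A B : finType) : #|A| = #|B| -> exists f : A -> B, bijective f.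
Proof.
move=> AB; exists (fun a => enum_val (cast_ord AB (enum_rank a))).
exists (fun b => enum_val (cast_ord (esym AB) (enum_rank b))) => a;
  by rewrite enum_valK ?cast_ordK ?cast_ordKV enum_rankK.
Qed.

(** * Composite numbers of pieces *)

Section Splitting.
Context (R : realType) (t : nat).
Hypothesis t_gt0 : (0 < t)%N.

(** Arbitrary finite types of cuts and pieces, and finite measures of any total mass, let the
    induction regroup the cuts and restrict the measures to a piece. [f] reads the piece off the
    pattern of sides. *)
Definition splits d (T : measurableType d) (I K : finType)
    (mu : 'I_t -> {finite_measure set T -> \bar R}) (h : I -> T -> R) :=
  exists (c : I -> R) (f : (I -> bool) -> K),
    (forall a, measurable [set y | f (fun i => h i y < c i) = a]) /\
    forall j a, mass (mu j) [set y | f (fun i => h i y < c i) = a] *+ #|K| =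
      mass (mu j) setT.

Lemma splits_prime d (T : measurableType d) (p : nat) (I K : finType)
    (mu : 'I_t -> {finite_measure set T -> \bar R}) (h : I -> T -> R) :
  prime p -> #|K| = p -> #|I| = (t * p.-1)%N ->
  (forall i, measurable_fun setT (h i)) -> (forall i y, -1 < h i y < 1) ->
  (forall j i r, mu j [set y | h i y = r] = 0%E) -> splits K mu h.
Proof.
move=> p_pr Kp Ip mh hitv hdiff.
have I0 : (0 < #|I|)%N.
  by rewrite Ip muln_gt0 t_gt0/= -subn1 subn_gt0 prime_gt1.
have /card_gt0P[i0 _] := I0.
(* [I] is enumerated to match the cuts numbered by [nat]; [i0] is a default past the end. *)
pose e l : I := if insub l is Some k then enum_val (k : 'I_#|I|) else i0.
have [g [r gr]] := @fair_prime _ T R p t p_pr mu (fun l => h (e l))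
  (fun l => mh (e l)) (fun l => hitv (e l)) (fun j l => hdiff j (e l)).
have [kap [kap' kapK kapK']] : exists kap : 'F_p -> K, bijective kap.
  by apply: card_eq_bijective; rewrite card_Fp.
pose x := labeling (fun l => h (e l)) g r (t * p.-1).
have xE y : decide g (fun l => h (e l) y < r (enum_rank (e l))) (t * p.-1) = x y.
  have E : labeling (fun l => h (e l)) g (fun l => r (enum_rank (e l))) (t * p.-1) = x.
    by apply: eq_labeling => // l; rewrite -Ip => lI; rewrite /e insubT/= enum_valK.
  exact: (congr1 (@^~ y) E).
exists (fun i => r (enum_rank i)), (fun b => kap (decide g (fun l => b (e l)) (t * p.-1))).
have setE a : [set y | kap (decide g (fun l => h (e l) y < r (enum_rank (e l))) (t * p.-1)) = a]
    = [set y | x y = kap' a].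
  apply/seteqP; split => y /=; rewrite xE; first by move=> <-; rewrite kapK.
  by move=> ->; rewrite kapK'.
have mx a : measurable [set y | x y = a].
  by apply: measurable_labeling => l; apply: mh.
split=> [a|j a]; rewrite setE// Kp -(sum_mass_fibers (mu j) mx).
rewrite (eq_bigr (fun=> mass (mu j) [set y | x y = kap' a])) => [|b _]; last exact: gr.
by rewrite sumr_const card_Fp.
Qed.

(* For k = p * q, each of the p pieces is split again into q pieces by its own
   cuts: p.-1 + p * q.-1 = (p * q).-1. *)
Theorem splits_all (k : nat) : (0 < k)%N ->
  forall d (T : measurableType d) (I K : finType)
    (mu : 'I_t -> {finite_measure set T -> \bar R}) (h : I -> T -> R),
  #|K| = k -> #|I| = (t * k.-1)%N ->
  (forall i, measurable_fun setT (h i)) -> (forall i y, -1 < h i y < 1) ->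
  (forall j i r, mu j [set y | h i y = r] = 0%E) -> splits K mu h.
Proof.
elim/ltn_ind: k => k IH k0 d T I K mu h Kk Ik mh hitv hdiff.
have [k1|k1] := leqP k 1.
  have {k1 k0} k1 : k = 1%N by apply/eqP; rewrite eqn_leq k1.
  have /fintype1P[a0 a0P] : #|K| == 1%N by rewrite Kk k1.
  have setE a : [set y : T | a0 = a] = setT.
    by apply/seteqP; split => y //= _; rewrite a0P.
  exists (fun=> 0), (fun=> a0); split => [a|j a]; rewrite setE//.
  by rewrite Kk k1.
pose p := pdiv k; pose q := (k %/ p)%N.
have p_pr : prime p := pdiv_prime k1.
have kpq : k = (p * q)%N by rewrite mulnC divnK// pdiv_dvd.
have q0 : (0 < q)%N by move: k0; rewrite kpq muln_gt0 => /andP[].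
have qk : (q < k)%N by rewrite kpq ltn_Pmull// prime_gt1.
have [phi [phi' phiK phiK']] : exists phi : 'I_(t * p.-1) + 'I_p * 'I_(t * q.-1) -> I,
    bijective phi.
  apply: card_eq_bijective; rewrite card_sum card_prod !card_ord Ik kpq.
  have := prime_gt0 p_pr; move: q0; case: (p) => // p'; case: (q) => // q' _ _.
  by rewrite mulnS addSn /= mulnDr mulnCA.
have [kap [kap' kapK kapK']] : exists kap : 'I_p * 'I_q -> K, bijective kap.
  by apply: card_eq_bijective; rewrite card_prod !card_ord Kk.
have [|||||c0 [f0 [m0 split0]]] :=
  @splits_prime d T p 'I_(t * p.-1) 'I_p mu (fun i => h (phi (inl i))) p_pr.
- by rewrite card_ord.
- by rewrite card_ord.
- by [].
- by [].
- by [].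
pose x0 y := f0 (fun i => h (phi (inl i)) y < c0 i).
have m0oo j a : (mu j [set y | x0 y = a] < +oo)%E.
  by rewrite ltey_eq fin_num_measure.
(* The induction hypothesis is applied to the restrictions of the measures to the piece [a], with
   the cuts reserved for it. *)
have sub a : splits 'I_q (fun j => mfrestr (m0 a) (m0oo j a))
    (fun i => h (phi (inr (a, i)))).
  apply: (IH q) => //; try by rewrite card_ord.
  move=> j i r; apply/eqP; rewrite -measure_le0.
  by rewrite -[leRHS](hdiff j (phi (inr (a, i))) r) /mfrestr /= /mrestr measureIl//;
    exact: measurable_level.
have [c /choice[f cf]] := choice sub.
have [m1 split1] := all_and2 cf.
pose x1 a y := f a (fun i => h (phi (inr (a, i))) y < c a i).
pose cc i := match phi' i with inl i0 => c0 i0 | inr ai => c ai.1 ai.2 end.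
pose f' b := let a := f0 (fun i => b (phi (inl i))) in
  kap (a, f a (fun i => b (phi (inr (a, i))))).
have xE y : f' (fun i => h i y < cc i) = kap (x0 y, x1 (x0 y) y).
  rewrite /f'.
  have -> : (fun i => h (phi (inl i)) y < cc (phi (inl i))) =
      (fun i => h (phi (inl i)) y < c0 i).
    by apply/funext => i; rewrite /cc phiK.
  cbv zeta; rewrite -/(x0 y); congr (kap (_, f _ _)).
  by apply/funext => i; rewrite /cc phiK.
exists cc, f'.
have setE a : [set y | f' (fun i => h i y < cc i) = a] =
    [set y | x1 (kap' a).1 y = (kap' a).2] `&` [set y | x0 y = (kap' a).1].
  apply/seteqP; split => y /=; rewrite xE; first by move=> <-; rewrite kapK.
  by move=> [E1 E2]; rewrite E2 E1 -surjective_pairing kapK'.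
split=> [a|j a]; rewrite setE; first by apply: measurableI; [apply: m1|apply: m0].
have E : mass (mu j) ([set y | x1 (kap' a).1 y = (kap' a).2] `&`
    [set y | x0 y = (kap' a).1]) *+ q = mass (mu j) [set y | x0 y = (kap' a).1].
  have := split1 (kap' a).1 j (kap' a).2.
  by rewrite card_ord /mass /= /mfrestr /mrestr setTI.
by rewrite Kk kpq (mulnC p q) mulrnA E -(split0 j (kap' a).1) card_ord.
Qed.

End Splitting.

(** * Hyperplanes and parts *)

Section Dotp.
Context (R : realType).

Lemma dotpE (d : nat) (x : R) (y : 'rV[R]_d) (v : 'rV[R]_d.+1) :
  dotp (row_mx (x%:M : 'rV[R]_1) y : 'rV[R]_d.+1) v =
  x * v 0 0 + dotp y (rsubmx (v : 'rV[R]_(1 + d))).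
Proof.
pose u := row_mx (x%:M : 'rV[R]_1) y.
have ul : u 0 (lshift d 0) = x by rewrite row_mxEl mxE.
have ur l : u 0 (rshift 1 l) = y 0 l by rewrite row_mxEr.
rewrite /dotp big_ord_recl; congr (_ * _ + _).
  by rewrite -[RHS]ul; congr (u 0 _); apply: val_inj.
apply: eq_bigr => l _; rewrite -ur [rsubmx _ _ _]mxE.
by congr (_ * _); [congr (u 0 _)|congr (v 0 _)]; apply: val_inj.
Qed.

Lemma dotpDl (d : nat) (x y v : 'rV[R]_d) a b :
  dotp (a *: x + b *: y) v = a * dotp x v + b * dotp y v.
Proof.
rewrite /dotp !mulr_sumr -big_split; apply: eq_bigr => l _.
by rewrite !mxE mulrDl !mulrA.
Qed.

Lemma continuous_dotp (d : nat) (v : 'rV[R]_d) : continuous (fun x => dotp x v).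
Proof.
apply: continuous_big => [|l _ x]; first exact: add_continuous.
exact: (cvgM (@coord_continuous R 1 d 0 l x) (cvg_cst _)).
Qed.

Lemma lebesgue_rV_set0 d : lebesgue_rV (set0 : set 'rV[R]_d) = 0%E.
Proof.
elim: d => [|d IH] /=; first by rewrite indic0.
by rewrite (eq_integral (cst 0%E)) ?integral0.
Qed.

(* [lebesgue_rV] is not known to be monotone, hence the arbitrary subset B. *)
Lemma lebesgue_rV_hyperplane d (v : 'rV[R]_d) c (B : set 'rV[R]_d) :
  v != 0 -> B `<=` [set x | dotp x v = c] -> lebesgue_rV B = 0%E.
Proof.
elim: d v c B => [|d IH] v c B v0 Bv /=; first by rewrite (thinmx0 v) eqxx in v0.
pose w := rsubmx (v : 'rV[R]_(1 + d)).
(* If v has a nonzero coordinate after the first, every section lies in a hyperplane of one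
   dimension less. Otherwise only the section over [c / v 0 0] can be nonempty, and a point has
   length 0. *)
have [w0|w0] := eqVneq w 0; last first.
  rewrite (eq_integral (cst 0%E)) ?integral0// => x _.
  by apply: (IH w (c - x * v 0 0)) => // y /Bv /=; rewrite dotpE => <-; rewrite addrAC subrr add0r.
have dotp0 (y : 'rV[R]_d) : dotp y w = 0.
  by rewrite w0; apply: big1 => l _; rewrite mxE mulr0.
have v00 : v 0 0 != 0.
  apply: contraNneq v0 => v00; apply/eqP/rowP => l; rewrite mxE.
  have [->//|[l' ->]] : l = 0 \/ exists l', l = rshift 1 (l' : 'I_d).
    case: (unliftP ord0 l) => [l' ->|->]; [right|by left].
    by exists l'; apply: val_inj.
  by have := congr1 (fun u : 'rV_d => u 0 l') w0; rewrite !mxE.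
pose K := lebesgue_rV [set y : 'rV[R]_d | B (row_mx ((c / v 0 0)%:M : 'rV[R]_1) y)].
transitivity (\int[@lebesgue_measure R]_x (if (x : R) == (c / v 0 0)%R then K else 0))%E.
  apply: eq_integral => x _; case: eqP => [->//|xc].
  rewrite -[RHS](lebesgue_rV_set0 d); congr lebesgue_rV.
  apply/seteqP; split => y //= /Bv /=; rewrite dotpE dotp0 addr0 => E.
  by apply: xc; rewrite -E mulfK.
rewrite (ae_eq_integral (cst 0%E)) ?integral0//.
  have meq : measurable_fun setT (fun x : measurableTypeR R => (x : R) == c / v 0 0).
    by apply: measurable_fun_eqr; [exact: measurable_id|exact: measurable_cst].
  exact: (measurable_fun_ifT meq (measurable_cst K) (measurable_cst 0%E)).
exists [set c / v 0 0]; split => //; first exact: lebesgue_measure_set1.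
by move=> x /= /not_implyP[_]; case: eqP.
Qed.

End Dotp.

Section Arrangement.
Context (R : realType) (d n : nat) (v : 'I_n -> 'rV[R]_d) (r : 'I_n -> R).

Let H (i : 'I_n) := [set x | dotp x (v i) = r i].
Let U := ~` \bigcup_(i in [set: 'I_n]) H i.

Definition side (x : 'rV[R]_d) (i : 'I_n) : bool := dotp x (v i) < r i.

Let off_hyperplane x i : U x -> dotp x (v i) != r i.
Proof. by move=> Ux; apply/eqP => E; apply: Ux; exists i. Qed.

(** The image of a component under the linear form is an interval that misses [r i]. *)
Let component_side x z : connected_component U x z -> side z =1 side x.
Proof.
move=> xz i; have zU := connected_component_sub xz.
have xU : U x by apply: connected_component_sub (connected_component_sym xz).
have : is_interval ((fun y => dotp y (v i)) @` connected_component U x).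
  apply/connected_intervalP/connected_continuous_connected.
    exact: component_connected.
  exact/continuous_subspaceT/continuous_dotp.
move=> itv.
have img y : connected_component U x y ->
  ((fun y => dotp y (v i)) @` connected_component U x) (dotp y (v i)) by exists y.
have noval : ~ ((fun y => dotp y (v i)) @` connected_component U x) (r i).
  by move=> [y /connected_component_sub yU /eqP]; apply/negP/off_hyperplane.
have xx := img _ (connected_component_refl xU); have zz := img _ xz.
rewrite /side; have [zr|zr] := ltP; have [xr|xr] := ltP => //.
  by case: noval; apply: itv zz xx _ _; rewrite (ltW zr).
by case: noval; apply: itv xx zz _ _; rewrite (ltW xr).
Qed.

(** Weak inequalities pass to the closure, and off the hyperplanes they are strict. *)
Lemma closure_component_side x z :
  U z -> closure (connected_component U x) z -> side z =1 side x.
Proof.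
move=> Uz cz i; have zr := off_hyperplane i Uz.
have clo (C : set R) : closed C ->
    (forall y, connected_component U x y -> C (dotp y (v i))) -> C (dotp z (v i)).
  move=> cC sC; suff : closed ((fun y => dotp y (v i)) @^-1` C).
    by move=> /closure_id E; have := closureS (sC : _ `<=` _) cz; rewrite -E.
  by apply: closed_comp => // y _; apply: continuous_dotp.
rewrite {1}/side; have [xr|xr] := boolP (side x i).
  rewrite lt_neqAle zr; apply: (clo [set a | a <= r i]).
    exact: closed_le.
  by move=> y /component_side/(_ i); rewrite xr => /ltW.
apply/negbTE; rewrite -leNgt; apply: (clo [set a | r i <= a]).
  exact: closed_ge.
by move=> y /component_side/(_ i); rewrite (negbTE xr) => /negbT; rewrite -leNgt.
Qed.

(** The segment from x to z meets no hyperplane, as its ends lie strictly on the same side of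
    each. *)
Lemma same_side_component x z : U x -> U z -> side x =1 side z ->
  connected_component U x = connected_component U z.
Proof.
move=> Ux Uz xz; apply: same_connected_component.
pose s (a : R) := (1 - a) *: x + a *: z.
exists (s @` `[0, 1]%classic); last by exists 1; rewrite ?/s ?subrr ?scale0r ?scale1r ?add0r//= in_itv/= ler01 lexx.
split.
- by exists 0; rewrite ?/s ?subr0 ?scale0r ?scale1r ?addr0//= in_itv/= ler01 lexx.
- move=> _ [a /= + <-] [i _]; rewrite in_itv/= => /andP[a0 a1]; rewrite /H/= dotpDl.
  have := xz i; rewrite /side; have := off_hyperplane i Ux; have := off_hyperplane i Uz.
  have pos (p q : R) : 0 < p -> 0 < q -> 0 < (1 - a) * p + a * q.
    by move=> p0 q0; have [pq|qp] := leP p q; nra.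
  have [zr|zr|//] := ltgtP (dotp z (v i)) (r i).
  + have [xr|xr|//] := ltgtP (dotp x (v i)) (r i) => // _ _ _.
    by have := pos (r i - dotp x (v i)) (r i - dotp z (v i)); rewrite !subr_gt0 => /(_ xr zr); lra.
  + have [xr|xr|//] := ltgtP (dotp x (v i)) (r i) => // _ _ _.
    by have := pos (dotp x (v i) - r i) (dotp z (v i) - r i); rewrite !subr_gt0 => /(_ xr zr); lra.
- apply: connected_continuous_connected; first exact: segment_connected.
  apply: continuous_subspaceT => a; apply: cvgD; apply: cvgZr_tmp; last exact: cvg_id.
  by apply: cvgB; [exact: cvg_cst|exact: cvg_id].
Qed.

Lemma finite_parts : finite_set (parts H).
Proof.
pose F (b : {ffun 'I_n -> bool}) :=
  closure (connected_component U (get [set x | U x /\ side x =1 b])).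
apply: (@sub_finite_set _ _ (F @` setT)); last exact/finite_image/finite_finset.
move=> _ [x Ux <-]; exists [ffun i => side x i] => //; rewrite /F.
have [|Uy yE] := @getPex _ [set y | U y /\ side y =1 [ffun i => side x i]].
  by exists x; split => // i; rewrite ffunE.
by congr closure; apply: same_side_component => // i; rewrite yE ffunE.
Qed.

(* On a set that is not a part, [get] returns a junk point. *)
Definition distribution (K : Type) (f : ('I_n -> bool) -> K) (P : set 'rV[R]_d) : K :=
  f (side (get [set x | U x /\ P = closure (connected_component U x)])).

(** Any part containing a point off the hyperplanes has the pattern of sides of that point, so
    overlaps of closed parts matter only on the hyperplanes. *)
Lemma distributed_off_hyperplanes k (f : ('I_n -> bool) -> 'I_k) a x : U x ->
  distributed H (distribution f) a x <-> f (side x) = a.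
Proof.
have distE z : U z -> distribution f (closure (connected_component U z)) = f (side z).
  move=> Uz; rewrite /distribution.
  have [|Uy yE] := @getPex _ [set y | U y /\
    closure (connected_component U z) = closure (connected_component U y)].
    by exists z.
  congr f; apply/funext => i; apply: esym; apply: closure_component_side => //.
  by rewrite -yE; apply/subset_closure/connected_component_refl.
move=> Ux; split=> [[_ [[z Uz <-] <-] xP]|<-].
  by rewrite distE//; congr f; apply/funext => i; apply: closure_component_side.
exists (closure (connected_component U x)).
  by split; [exists x|apply: distE].
exact/subset_closure/connected_component_refl.
Qed.

Lemma measurable_distributed k (f : set 'rV[R]_d -> 'I_k) a :
  measurable (distributed H f a : set (borel_rV R d)).
Proof.
apply: fin_bigcup_measurable.
  by apply: sub_finite_set finite_parts => P [].
move=> _ [[x _ <-] _]; rewrite -[X in measurable X]setCK; apply: measurableC.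
by apply: sub_sigma_algebra; apply/closed_openC/closed_closure.
Qed.

End Arrangement.

(* A cut at infinity is replaced by an arbitrary hyperplane, whose sides are
   then ignored. *)
Lemma contract_threshold (R : realType) (c : R) :
  exists (r : R) (phi : bool -> bool),
    forall x : R, (contract x%:E < c) = phi (x < r).
Proof.
have [c1|c1] := leP 1 c.
  exists 0, (fun=> true) => x; apply: lt_le_trans c1.
  exact: le_lt_trans (ler_norm _) (contract_lt1 x).
have [cN1|cN1] := leP c (-1).
  exists 0, (fun=> false) => x; apply/negbTE; rewrite -leNgt (le_trans cN1)// ltW//.
  by have := contract_lt1 x; rewrite ltr_norml => /andP[].
have c1' : `|c| < 1 by rewrite ltr_norml cN1.
exists (fine (expand c)), id => x.
by rewrite -[in LHS](expandK (ltW c1' : c \in [pred r | `|r| <= 1])) lt_contract -fine_expand// lte_fin.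
Qed.

Lemma continuous_contract (R : realType) : continuous (fun x : R => contract x%:E).
Proof.
move=> x; apply: cvgM; first exact: cvg_id.
apply: cvgV; first by rewrite gt_eqF// ltr_pwDl.
by apply: cvgD; [exact: cvg_cst|apply: cvg_norm; exact: cvg_id].
Qed.

Section RowVectors.
Context (R : realType) (d : nat).

Lemma measurable_closed_rV (A : set (borel_rV R d)) :
  closed (A : set 'rV[R]_d) -> measurable A.
Proof.
move=> cA; rewrite -[X in measurable X]setCK; apply: measurableC.
by apply: sub_sigma_algebra; apply/closed_openC.
Qed.

Lemma measurable_continuous_rV (f : 'rV[R]_d -> R) :
  continuous f -> measurable_fun setT (f : borel_rV R d -> R).
Proof.
move=> /continuousP cf; apply: (measurability _ (RGenOpens.measurableE R)).
move=> _ [_ [a [b ->] <-]]; rewrite setTI; apply: sub_sigma_algebra.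
exact/cf/interval_open.
Qed.

Lemma closed_hyperplane (v : 'rV[R]_d) c : closed [set x | dotp x v = c].
Proof.
apply: (@closed_comp _ _ (fun x => dotp x v) [set c]); last exact: closed_eq.
by move=> x _; apply: continuous_dotp.
Qed.

Lemma hyperplane_null (mu : {measure set (borel_rV R d) -> \bar R}) v c :
  mu `<< @lebesgue_rV R d -> v != 0 -> mu [set x | dotp x v = c] = 0%E.
Proof.
move=> ac v0; apply: (ac [set x | dotp x v = c]) => //.
  by move=> A mA Ac; apply: lebesgue_rV_hyperplane Ac.
apply: measurable_closed_rV; exact: closed_hyperplane.
Qed.

End RowVectors.

Theorem theorem3p4 (R : realType) (k t d : nat)
  (k_gt0 : (0 < k)%N) (t_gt0 : (0 < t)%N) (d_gt0 : (0 < d)%N)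
  (n : nat) (n_def : n = (t * (k - 1))%N)
  (mu : 'I_t -> probability (borel_rV R d) R)
  (mu_ac : forall j : 'I_t, mu j `<< @lebesgue_rV R d)
  (v : 'I_n -> 'rV[R]_d) (v_neq0 : forall i : 'I_n, v i != 0) :
  exists H : 'I_n -> set 'rV[R]_d,
    (forall i : 'I_n, hyperplane_orthogonal (v i) (H i)) /\
    exists f : set 'rV[R]_d -> 'I_k,
      forall (i : 'I_k) (j : 'I_t),
        mu j (distributed H f i) = (k%:R^-1 : R)%:E.
Proof.
have hyp0 j i c : mu j [set x | dotp x (v i) = c] = 0%E.
  exact: (hyperplane_null _ (mu_ac j) (v_neq0 i)).
(* The increasing map [contract] brings the linear forms into ]-1, 1[, where [splits_all] needs
   them. *)
have [|||||c [f [mf eqf]]] := @splits_all R t t_gt0 k k_gt0 _ (borel_rV R d) 'I_n 'I_k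
  mu (fun i x => contract (dotp x (v i))%:E).
- by rewrite card_ord.
- by rewrite card_ord n_def subn1.
- move=> i; apply: measurable_continuous_rV => x.
  apply: (continuous_comp (f := fun x => dotp x (v i)) (g := fun a : R => contract a%:E)).
    exact: continuous_dotp.
  exact: continuous_contract.
- by move=> i x; have := contract_lt1 (dotp x (v i)); rewrite ltr_norml.
(* By injectivity of [contract], a level set is a hyperplane or empty. *)
- move=> j i c; have [[x0 xc]|no] := pselect (exists x, contract (dotp x (v i))%:E = c).
    rewrite -[RHS](hyp0 j i (dotp x0 (v i))); congr (mu j _).
    apply/seteqP; split => x /=; last by move=> ->.
    by rewrite -xc => E; apply: EFin_inj; apply: contract_inj.
  rewrite -[RHS](measure0 (mu j)); congr (mu j _).
  by apply/seteqP; split => x //= xc; apply: no; exists x.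
have [r /choice[phi phiP]] := choice (fun i => contract_threshold (c i)).
pose H i := [set x | dotp x (v i) = r i].
pose f' b := f (fun i => phi i (b i)).
exists H; split; first by move=> i; exists (r i).
exists (distribution v r f') => a j.
set A := distributed _ _ _.
pose B := [set x | f (fun i => contract (dotp x (v i))%:E < c i) = a].
have mA : measurable (A : set (borel_rV R d)) by apply: measurable_distributed.
have mB : measurable (B : set (borel_rV R d)) by apply: mf.
(* The union of the hyperplanes is null, and outside it the distributed parts agree with the fair
   pieces. *)
have [N [mN N0 NH]] : exists N : set (borel_rV R d),
    [/\ measurable N, mu j N = 0%E & forall i, H i `<=` N].
  have mH i : measurable (H i : set (borel_rV R d)).
    by apply: measurable_closed_rV; apply: closed_hyperplane.
  have null s : measurable (\big[setU/set0]_(i <- s) H i : set (borel_rV R d)) /\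
      mu j (\big[setU/set0]_(i <- s) H i) = 0%E.
    elim: s => [|i s [ms s0]]; first by rewrite big_nil measure0.
    by rewrite big_cons measureU0//; split; [exact: measurableU|exact: hyp0].
  have [mN N0] := null (index_enum 'I_n).
  exists (\big[setU/set0]_(i < n) H i); split => // i x Hx.
  by rewrite (bigD1 i)//=; left.
have diff0 C : measurable C -> mu j C = mu j (C `\` N).
  move=> mC; rewrite [LHS](measureDI _ mC mN).
  by rewrite [X in (_ + X)%E](subset_measure0 _ mN _ N0) ?adde0//; apply: measurableI.
have ABN : A `\` N = B `\` N.
  have off x : ~ N x -> A x <-> B x.
    move=> Nx; rewrite /A distributed_off_hyperplanes.
      rewrite /B /f' /=; suff -> : (fun i => contract (dotp x (v i))%:E < c i) =
        (fun i => phi i (side v r x i)) by [].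
      by apply/funext => i; rewrite phiP.
    by move=> [i _ Hx]; apply/Nx/NH/Hx.
  by apply/seteqP; split => x [Cx Nx]; split => //; apply/(off _ Nx).
rewrite [LHS](diff0 _ mA) ABN -(diff0 _ mB) massE//; congr EFin.
have kB : mass (mu j) B *+ k = 1.
  rewrite -[RHS](congr1 fine (probability_setT (mu j))) -[RHS](eqf j a).
  by rewrite card_ord.
have k0 : k%:R != 0 :> R by rewrite pnatr_eq0 -lt0n.
by apply: (mulIf k0); rewrite mulr_natr kB mulVf.
Qed.
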